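(* Let $\lambda\in P^+$ be non-zero and let $\boldsymbol\xi=(\xi^\alpha)_{\alpha\in R^+}$ be a $\lambda$-compatible tuple of partitions. The module $V(\boldsymbol\xi)$ is generated by the element $v_{\boldsymbol\xi}$ with defining relations $$\mathfrak n^+[t]v_{\boldsymbol\xi}=0,\quad (h\otimes t^s)v_{\boldsymbol\xi}=\delta_{s,0}\lambda(h)v_{\boldsymbol\xi}\ (h\in\mathfrak h,\ s\in\mathbf Z_+),\quad (x_i^-\otimes1)^{\lambda(h_i)+1}v_{\boldsymbol\xi}=0\ (i\in I),$$ and $${}_k\mathbf x^-_\alpha(r,s)v_{\boldsymbol\xi}=0\quad\text{for all }\alpha\in R^+,\ s,r,k\in\mathbf N\text{ with } s+r\ge1+kr+\sum_{j\ge k+1}\xi^\alpha_j.$$ In particular, for all $\alpha\in R^+$ and $r,k\in\mathbf N$ with $r\ge1+\sum_{j\ge k+1}\xi^\alpha_j$, we have $(x_\alpha^-\otimes t^k)^rv_{\boldsymbol\xi}=0$.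
   Context: $\mathbf Z_+$ is the set of non-negative integers, $\mathbf N$ the positive integers. $\mathfrak g$ is a simple finite-dimensional complex Lie algebra with Cartan subalgebra $\mathfrak h$, simple roots $\alpha_i$ ($i\in I=\{1,\dots,n\}$), positive roots $R^+$, dominant integral weights $P^+$, $\mathfrak n^+=\bigoplus_{\alpha\in R^+}\mathfrak g_\alpha$. For $\alpha\in R^+$, $h_\alpha$ is the coroot and $x^\pm_\alpha\in\mathfrak g_{\pm\alpha}$ are non-zero root vectors with $[h_\alpha,x_\alpha^\pm]=\pm2x_\alpha^\pm$, $[x^+_\alpha,x^-_\alpha]=h_\alpha$; $x_i^\pm=x^\pm_{\alpha_i}$, $h_i=h_{\alpha_i}$. $\mathfrak a[t]=\mathfrak a\otimes\mathbf C[t]$ is the current algebra of a Lie algebra $\mathfrak a$. The local Weyl module $W_{\rm loc}(\lambda)$ is the $\mathfrak g[t]$-module generated by $w_\lambda$ with defining relations $(x_i^+\otimes\mathbf C[t])w_\lambda=0$, $(h_i\otimes t^s)w_\lambda=\lambda(h_i)\delta_{s,0}w_\lambda$, $(x_i^-\otimes1)^{\lambda(h_i)+1}w_\lambda=0$ ($i\in I$, $s\in\mathbf Z_+$). A $\lambda$-compatible tuple is a family $\boldsymbol\xi=(\xi^\alpha)_{\alpha\in R^+}$ of partitions $\xi^\alpha=(\xi^\alpha_1\ge\xi^\alpha_2\ge\cdots\ge0)$ with $\sum_{j\ge1}\xi^\alpha_j=\lambda(h_\alpha)$. $V(\boldsymbol\xi)$ is the quotient of $W_{\rm loc}(\lambda)$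 by the submodule generated by all elements $(x_\alpha^+\otimes t)^s(x_\alpha^-\otimes1)^{s+r}w_\lambda$ with $\alpha\in R^+$, $s,r\in\mathbf N$ such that $s+r\ge1+rk+\sum_{j\ge k+1}\xi^\alpha_j$ for some $k\in\mathbf N$; $v_{\boldsymbol\xi}$ is the image of $w_\lambda$. For $x\in\mathfrak g$ and $r,s,k\in\mathbf Z_+$, with $y^{(p)}=y^p/p!$, $${}_k\mathbf x(r,s)=\sum(x\otimes t^k)^{(b_k)}(x\otimes t^{k+1})^{(b_{k+1})}\cdots(x\otimes t^s)^{(b_s)}\in\mathbf U(\mathfrak g[t]),$$ the sum over all sequences $(b_p)_{p\ge0}$ of non-negative integers with $b_p=0$ for $p<k$, $\sum_pb_p=r$, $\sum_ppb_p=s$ (and ${}_k\mathbf x(r,s)=0$ if there are none). ${}_k\mathbf x_\alpha^-(r,s)$ is this element for $x=x_\alpha^-$. *)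

(* Defs.v *)
From HB Require Import structures.
From mathcomp Require Import all_boot all_order all_algebra.
From mathcomp Require Import generic_quotient ring_quotient finmap.
From mathcomp Require Import boolp reals complex.
From mathcomp.multinomials Require Import monalg.

Set Implicit Arguments.
Unset Strict Implicit.
Unset Printing Implicit Defensive.

Import GRing.Theory.
Local Open Scope ring_scope.
Local Open Scope quotient_scope.

HB.mixin Record Lmodule_isLie (K : fieldType) (L : Type)
  of GRing.Lmodule K L := {
  lie : L -> L -> L;
  lie_linl : forall (a : K) (x y z : L), lie (a *: x + y) z = a *: lie x z + lie y z;
  lie_linr : forall (a : K) (x y z : L), lie z (a *: x + y) = a *: lie z x + lie z y;
  liexx : forall x : L, lie x x = 0;
  lie_jacobi : forall x y z : L,
    lie x (lie y z) + lie y (lie z x) + lie z (lie x y) = 0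
}.

#[short(type="lieAlgType")]
HB.structure Definition LieAlgebra (K : fieldType) :=
  {L of GRing.Lmodule K L & Lmodule_isLie K L}.

#[short(type="finLieAlgType")]
HB.structure Definition FinLieAlgebra (K : fieldType) :=
  {L of Vector K L & Lmodule_isLie K L}.

Inductive submod_gen (A : pzRingType) (M : lmodType A) (S : M -> Prop) :
    M -> Prop :=
| submod_gen0 : submod_gen S 0
| submod_genD a s x : S s -> submod_gen S x -> submod_gen S (a *: s + x).

Fact quot_module_key : unit. Proof. by []. Qed.

Section QuotientModule.
Context (A : pzRingType) (M : lmodType A) (S : M -> Prop).

Lemma submod_gen_lin a x y :
  submod_gen S x -> submod_gen S y -> submod_gen S (a *: x + y).
Proof.
move=> Sx Sy; elim: Sx => [|b s z Ss _ IH]; first by rewrite scaler0 add0r.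
by rewrite scalerDr scalerA -addrA; apply: submod_genD.
Qed.

Definition submod_pred : pred M := fun x => `[< submod_gen S x >].

Lemma submod_zmod_closed : zmod_closed submod_pred.
Proof.
split=> [|x y]; rewrite !unfold_in.
  by apply/asboolP; apply: submod_gen0.
move=> /asboolP Sx /asboolP Sy; apply/asboolP.
by rewrite addrC -scaleN1r; apply: submod_gen_lin.
Qed.

HB.instance Definition _ :=
  GRing.isZmodClosed.Build M submod_pred submod_zmod_closed.

Definition quot_module := 
  @Quotient.quot M (GRing.ZmodClosed.clone M submod_pred _).

HB.instance Definition _ := GRing.Zmodule.on quot_module.
HB.instance Definition _ := Quotient.on quot_module.

Definition quot_module_pi (x : M) : quot_module := \pi_quot_module x.

Lemma quot_module_piP x y :
  quot_module_pi x = quot_module_pi y <-> submod_gen S (x - y).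
Proof.
have e : (quot_module_pi x == quot_module_pi y) = (submod_pred (x - y)).
  by rewrite /quot_module_pi -Quotient.idealrBE.
split=> [/eqP|Sxy]; first by rewrite e => /asboolP.
by apply/eqP; rewrite e; apply/asboolP.
Qed.

Lemma quot_module_piD x y :
  quot_module_pi (x + y) = quot_module_pi x + quot_module_pi y.
Proof. exact: Quotient.pi_add. Qed.

Lemma quot_module_reprK (x : quot_module) : quot_module_pi (repr x) = x.
Proof. exact: reprK. Qed.

Definition quot_module_scale : A -> quot_module -> quot_module :=
  locked_with quot_module_key (fun a x => quot_module_pi (a *: repr x)).

Lemma quot_module_piZ a x :
  quot_module_pi (a *: x) = quot_module_scale a (quot_module_pi x).
Proof.
rewrite /quot_module_scale unlock.
apply/quot_module_piP; rewrite -scalerBr -[_ *: _]addr0.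
apply: submod_gen_lin; last exact: submod_gen0.
by apply/quot_module_piP; rewrite quot_module_reprK.
Qed.

Fact quot_module_scaleA a b x :
  quot_module_scale a (quot_module_scale b x) = quot_module_scale (a * b) x.
Proof. by rewrite -[x]quot_module_reprK -!quot_module_piZ scalerA. Qed.

Fact quot_module_scale1 : left_id 1 quot_module_scale.
Proof. by move=> x; rewrite -[x]quot_module_reprK -quot_module_piZ scale1r. Qed.

Fact quot_module_scaleDr : right_distributive quot_module_scale +%R.
Proof.
move=> a x y; rewrite -[x]quot_module_reprK -[y]quot_module_reprK.
by rewrite -quot_module_piD -!quot_module_piZ scalerDr quot_module_piD.
Qed.

Fact quot_module_scaleDl x :
  {morph quot_module_scale^~ x : a b / a + b}.
Proof.
move=> a b; rewrite -[x]quot_module_reprK.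
by rewrite -!quot_module_piZ scalerDl quot_module_piD.
Qed.

HB.instance Definition _ := GRing.Zmodule_isLmodule.Build A quot_module
  quot_module_scaleA quot_module_scale1 quot_module_scaleDr
  quot_module_scaleDl.

End QuotientModule.

Arguments quot_module_pi {A M} S x.

(* [M] is generated by [m] with defining relations [a m = 0] for [a] in      *)
(* [rel]: the annihilator of [m] is the left ideal generated by [rel].       *)
Definition presented_by (A : pzRingType) (M : lmodType A) (m : M)
    (rel : A^o -> Prop) : Prop :=
  (forall x : M, exists a : A, x = a *: m) /\
  (forall a : A, a *: m = 0 <-> submod_gen rel (a : A^o)).

(* The universal enveloping algebra: the free associative algebra on the set *)
(* [L] modulo the two-sided ideal making [L -> U(L)] a Lie homomorphism.     *)

Fact envel_key : unit. Proof. by []. Qed.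

Lemma ring_auxM (A : pzRingType) (a b c s d w : A) :
  a * (c * s * d + w) * b = (a * c) * s * (d * b) + a * w * b.
Proof. by rewrite mulrDr mulrDl !mulrA. Qed.

Lemma ring_auxB (A : pzRingType) (u v u' v' : A) :
  u * v - u' * v' = (u - u') * v + u' * (v - v').
Proof. by rewrite mulrBl mulrBr addrA subrK. Qed.

Section Augmentation.
Context (A B : pzRingType) (e : {rmorphism A -> B}).

Lemma augmentation_ideal a s b u : e s = 0 -> e u = 0 -> e (a * s * b + u) = 0.
Proof. by move=> es eu; rewrite rmorphD !rmorphM es eu mulr0 mul0r addr0. Qed.

Lemma augmentation_lin x y z : e x = 0 -> e y = 0 -> e z = 0 ->
  e (x - (y + z)) = 0.
Proof. by move=> ex ey ez; rewrite rmorphB rmorphD ex ey ez addr0 subr0. Qed.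

Lemma augmentation_lie x y z : e x = 0 -> e y = 0 -> e z = 0 ->
  e (x * y - y * x - z) = 0.
Proof. by move=> ex ey ez; rewrite !rmorphB !rmorphM ex ey ez mulr0 !subr0. Qed.

End Augmentation.

Section Enveloping.
Context (K : fieldType) (L : lieAlgType K).

Local Notation F := {malg K[{fmonom L}]}.

Definition free_gen (x : L) : F := << fmu x >>.

Inductive envel_rel : F -> Prop :=
| envel_rel_lin a x y :
    envel_rel (free_gen (a *: x + y) - (a *: free_gen x + free_gen y))
| envel_rel_lie x y :
    envel_rel (free_gen x * free_gen y - free_gen y * free_gen x
               - free_gen (lie x y)).

Inductive envel_ideal : F -> Prop :=
| envel_ideal0 : envel_ideal 0
| envel_idealD a s b u :
    envel_rel s -> envel_ideal u -> envel_ideal (a * s * b + u).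

Lemma envel_ideal_add u v : envel_ideal u -> envel_ideal v -> envel_ideal (u + v).
Proof.
move=> Iu Iv; elim: Iu => [|a s b w Ss _ IH]; first by rewrite add0r.
by rewrite -addrA; apply: envel_idealD.
Qed.

Lemma envel_idealM a b u : envel_ideal u -> envel_ideal (a * u * b).
Proof.
elim=> [|c s d w Ss _ IH]; first by rewrite mulr0 mul0r; apply: envel_ideal0.
have -> : a * (c * s * d + w) * b = (a * c) * s * (d * b) + a * w * b.
  exact: ring_auxM.
exact: envel_idealD.
Qed.

Lemma envel_idealMl a u : envel_ideal u -> envel_ideal (a * u).
Proof. by move=> Iu; rewrite -[_ * u]mulr1; apply: envel_idealM. Qed.

Lemma envel_idealMr a u : envel_ideal u -> envel_ideal (u * a).
Proof. by move=> Iu; rewrite -[u]mul1r; apply: envel_idealM. Qed.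

Lemma envel_ideal_proper : ~ envel_ideal 1.
Proof.
pose e : {rmorphism F -> K} := mcoeff mone.
have eg x : e (free_gen x) = 0.
  rewrite /= /free_gen mcoeffU1 -[fmu x == mone]/(fmu x == fmone L).
  by rewrite /fmone /fmu -val_eqE /= !fmE.
have eZ c (u : F) : e (c *: u) = c * e u by apply: mcoeffZ.
suff I0 (u : F) : envel_ideal u -> e u = 0.
  by move=> /I0 /eqP; rewrite (rmorph1 e) oner_eq0.
elim=> [|a s b v Ss _ IH]; first exact: (rmorph0 e).
apply: augmentation_ideal => //; case: Ss => [c x y|x y].
  by apply: augmentation_lin; rewrite ?eZ eg ?mulr0.
exact: augmentation_lie.
Qed.

Definition envel_pred : pred F := fun u => `[< envel_ideal u >].

Lemma envel_zmod_closed : zmod_closed envel_pred.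
Proof.
split=> [|u v]; rewrite !unfold_in.
  by apply/asboolP; apply: envel_ideal0.
move=> /asboolP Iu /asboolP Iv; apply/asboolP.
by apply: envel_ideal_add => //; rewrite -mulN1r; apply: envel_idealMl.
Qed.

HB.instance Definition _ :=
  GRing.isZmodClosed.Build F envel_pred envel_zmod_closed.

Definition envel := 
  @Quotient.quot F (GRing.ZmodClosed.clone F envel_pred _).

HB.instance Definition _ := GRing.Zmodule.on envel.
HB.instance Definition _ := Quotient.on envel.

Definition envel_pi (u : F) : envel := \pi_envel u.

Lemma envel_piP u v : envel_pi u = envel_pi v <-> envel_ideal (u - v).
Proof.
have e : (envel_pi u == envel_pi v) = (envel_pred (u - v)).
  by rewrite /envel_pi -Quotient.idealrBE.
split=> [/eqP|Iuv]; first by rewrite e => /asboolP.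
by apply/eqP; rewrite e; apply/asboolP.
Qed.

Lemma envel_piD u v : envel_pi (u + v) = envel_pi u + envel_pi v.
Proof. exact: Quotient.pi_add. Qed.

Lemma envel_reprK (u : envel) : envel_pi (repr u) = u.
Proof. exact: reprK. Qed.

Definition envel_one : envel := envel_pi 1.
Definition envel_mul : envel -> envel -> envel :=
  locked_with envel_key (fun u v => envel_pi (repr u * repr v)).
Definition envel_scale : K -> envel -> envel :=
  locked_with envel_key (fun a u => envel_pi (a *: repr u)).

Lemma envel_piM u v : envel_pi (u * v) = envel_mul (envel_pi u) (envel_pi v).
Proof.
rewrite /envel_mul unlock; apply/envel_piP; set u' := repr _; set v' := repr _.
rewrite (ring_auxB u v u' v').
apply: envel_ideal_add; [apply: envel_idealMr | apply: envel_idealMl].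
  by apply/envel_piP; rewrite envel_reprK.
by apply/envel_piP; rewrite envel_reprK.
Qed.

Lemma envel_piZ a u : envel_pi (a *: u) = envel_scale a (envel_pi u).
Proof.
rewrite /envel_scale unlock; apply/envel_piP; rewrite -scalerBr -mul_malgC; apply: envel_idealMl.
by apply/envel_piP; rewrite envel_reprK.
Qed.

Fact envel_mulA : associative envel_mul.
Proof.
move=> u v w; rewrite -[u]envel_reprK -[v]envel_reprK -[w]envel_reprK.
by rewrite -!envel_piM mulrA.
Qed.

Fact envel_mul1 : left_id envel_one envel_mul.
Proof. by move=> u; rewrite -[u]envel_reprK -envel_piM mul1r. Qed.

Fact envel_mulr1 : right_id envel_one envel_mul.
Proof. by move=> u; rewrite -[u]envel_reprK -envel_piM mulr1. Qed.

Fact envel_mulDl : left_distributive envel_mul +%R.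
Proof.
move=> u v w; rewrite -[u]envel_reprK -[v]envel_reprK -[w]envel_reprK.
by rewrite -envel_piD -!envel_piM mulrDl envel_piD.
Qed.

Fact envel_mulDr : right_distributive envel_mul +%R.
Proof.
move=> u v w; rewrite -[u]envel_reprK -[v]envel_reprK -[w]envel_reprK.
by rewrite -envel_piD -!envel_piM mulrDr envel_piD.
Qed.

Fact envel_oner_neq0 : envel_one != 0.
Proof.
apply/eqP; rewrite -[0 : envel]subr0 -[0 - 0 : envel]envel_reprK subr0.
move=> /envel_piP I1; apply: envel_ideal_proper.
rewrite -[1](subrK (repr (0 : envel))); apply: envel_ideal_add => //.
rewrite -[repr _]subr0; apply/envel_piP; rewrite envel_reprK.
by rewrite -[RHS]addr0 -[X in _ = _ + X](subrr (envel_pi 0)) addrA -envel_piD addr0 subrr.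
Qed.

HB.instance Definition _ := GRing.Zmodule_isNzRing.Build envel
  envel_mulA envel_mul1 envel_mulr1 envel_mulDl envel_mulDr envel_oner_neq0.

Fact envel_scaleA a b u :
  envel_scale a (envel_scale b u) = envel_scale (a * b) u.
Proof. by rewrite -[u]envel_reprK -!envel_piZ scalerA. Qed.

Fact envel_scale1 : left_id 1 envel_scale.
Proof. by move=> u; rewrite -[u]envel_reprK -envel_piZ scale1r. Qed.

Fact envel_scaleDr : right_distributive envel_scale +%R.
Proof.
move=> a u v; rewrite -[u]envel_reprK -[v]envel_reprK.
by rewrite -envel_piD -!envel_piZ scalerDr envel_piD.
Qed.

Fact envel_scaleDl u : {morph envel_scale^~ u : a b / a + b}.
Proof.
by move=> a b; rewrite -[u]envel_reprK -!envel_piZ scalerDl envel_piD.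
Qed.

HB.instance Definition _ := GRing.Zmodule_isLmodule.Build K envel
  envel_scaleA envel_scale1 envel_scaleDr envel_scaleDl.

Lemma envel_pi_mul u v : envel_pi (u * v) = envel_pi u * envel_pi v.
Proof. exact: envel_piM. Qed.

Lemma envel_pi_scale a u : envel_pi (a *: u) = a *: envel_pi u.
Proof. exact: envel_piZ. Qed.

Fact envel_scaleAl (a : K) (u v : envel) : a *: (u * v) = a *: u * v.
Proof.
rewrite -[u]envel_reprK -[v]envel_reprK -envel_pi_mul.
by rewrite -envel_pi_scale scalerAl envel_pi_mul envel_pi_scale.
Qed.

HB.instance Definition _ := GRing.Lmodule_isLalgebra.Build K envel envel_scaleAl.

Lemma free_alg_scaleAr a (u v : F) : a *: (u * v) = u * (a *: v).
Proof.
have aC (w : F) : a%:MP * w = w * a%:MP.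
  rewrite mul_malgC malgZ_def malgM_def fgmulgU.
  by apply: eq_bigr => k _; rewrite mulrC mulm1.
by rewrite -!mul_malgC !mulrA aC.
Qed.

Fact envel_scaleAr (a : K) (u v : envel) : a *: (u * v) = u * (a *: v).
Proof.
rewrite -[u]envel_reprK -[v]envel_reprK -envel_pi_mul.
by rewrite -envel_pi_scale free_alg_scaleAr envel_pi_mul envel_pi_scale.
Qed.

HB.instance Definition _ := GRing.Lalgebra_isAlgebra.Build K envel envel_scaleAr.

Definition envel_in (x : L) : envel := envel_pi (free_gen x).

Lemma envel_ideal_rel u : envel_rel u -> envel_ideal u.
Proof.
move=> Su; have -> : u = 1 * u * 1 + 0 by rewrite addr0 mulr1 mul1r.
exact: envel_idealD envel_ideal0.
Qed.

Lemma envel_in_lin a x y :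
  envel_in (a *: x + y) = a *: envel_in x + envel_in y.
Proof.
rewrite /envel_in -envel_pi_scale -envel_piD; apply/envel_piP.
exact/envel_ideal_rel/envel_rel_lin.
Qed.

Lemma envel_in_lie x y :
  envel_in (lie x y) = envel_in x * envel_in y - envel_in y * envel_in x.
Proof.
apply/esym/eqP; rewrite subr_eq; apply/eqP.
rewrite /envel_in -(envel_pi_mul (free_gen x)) -(envel_pi_mul (free_gen y)).
rewrite -envel_piD; apply/envel_piP; rewrite opprD addrA addrAC.
exact/envel_ideal_rel/envel_rel_lie.
Qed.

End Enveloping.

(* The current algebra [L[t]]: polynomials in [t] with coefficients in [L],  *)
(* [<< x *g s >>] being [x (x) t^s].                                         *)

Definition current (K : fieldType) (L : lieAlgType K) : Type := {malg L[nat]}.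

Section Current.
Context (K : fieldType) (L : lieAlgType K).

HB.instance Definition _ := GRing.Zmodule.on (current L).

Implicit Types (p q r : current L).

Definition current_coef p (s : nat) : L := mcoeff s (p : {malg L[nat]}).

Definition tensor_pow (x : L) (s : nat) : current L := << x *g s >>.

Definition current_scale (a : K) p : current L :=
  \sum_(s <- msupp p) tensor_pow (a *: current_coef p s) s.

Definition current_lie p q : current L :=
  \sum_(i <- msupp p) \sum_(j <- msupp q)
     tensor_pow (lie (current_coef p i) (current_coef q j)) (i + j).

Lemma currentP p q : (forall s, current_coef p s = current_coef q s) <-> p = q.
Proof. by split=> [e|->//]; apply/malgP. Qed.

Lemma current_coefD p q s :
  current_coef (p + q) s = current_coef p s + current_coef q s.
Proof. exact: mcoeffD. Qed.

Lemma tensor_powD x y s : tensor_pow (x + y) s = tensor_pow x s + tensor_pow y s.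
Proof. exact: monalgUD. Qed.

Lemma tensor_pow0 s : tensor_pow 0 s = 0.
Proof. exact: monalgU0. Qed.

Lemma current_coef_tensor x s k :
  current_coef (tensor_pow x s) k = if s == k then x else 0.
Proof. by rewrite /current_coef mcoeffU; case: eqP. Qed.

Lemma current_coefZ a p s : current_coef (current_scale a p) s = a *: current_coef p s.
Proof.
rewrite {2}(monalgE p) /current_coef /current_scale !raddf_sum /=.
by apply: eq_bigr => i _; rewrite !mcoeffU; case: eqP; rewrite ?mulr1n ?mulr0n ?scaler0.
Qed.

Fact current_scaleA a b p :
  current_scale a (current_scale b p) = current_scale (a * b) p.
Proof. by apply/currentP => s; rewrite !current_coefZ scalerA. Qed.

Fact current_scale1 : left_id 1 current_scale.
Proof. by move=> p; apply/currentP => s; rewrite current_coefZ scale1r. Qed.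

Fact current_scaleDr : right_distributive current_scale +%R.
Proof.
by move=> a p q; apply/currentP => s; rewrite !(current_coefZ, current_coefD) scalerDr.
Qed.

Fact current_scaleDl p : {morph current_scale^~ p : a b / a + b}.
Proof.
by move=> a b; apply/currentP => s; rewrite !(current_coefZ, current_coefD) scalerDl.
Qed.

HB.instance Definition _ := GRing.Zmodule_isLmodule.Build K (current L)
  current_scaleA current_scale1 current_scaleDr current_scaleDl.

Lemma lie0l (x : L) : lie 0 x = 0.
Proof.
have /eqP := @lie_linl K L 1 0 0 x.
by rewrite !scale1r addr0 -subr_eq0 opprD addrA subrr sub0r oppr_eq0 => /eqP.
Qed.

Lemma lie0r (x : L) : lie x 0 = 0.
Proof.
have /eqP := @lie_linr K L 1 0 0 x.
by rewrite !scale1r addr0 -subr_eq0 opprD addrA subrr sub0r oppr_eq0 => /eqP.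
Qed.

Lemma current_lieEw (d1 d2 : {fset nat}) p q :
  (msupp p `<=` d1)%fset -> (msupp q `<=` d2)%fset ->
  current_lie p q = \sum_(i <- d1) \sum_(j <- d2)
     tensor_pow (lie (current_coef p i) (current_coef q j)) (i + j).
Proof.
move=> le1 le2; rewrite /current_lie (big_fset_incl _ le1) /=.
  apply: eq_bigr => i _; apply: big_fset_incl => // k _ /mcoeff_outdom qk.
  by rewrite /current_coef qk lie0r tensor_pow0.
move=> k _ /mcoeff_outdom pk.
by rewrite big1 // => j _; rewrite /current_coef pk lie0l tensor_pow0.
Qed.

Lemma tensor_pow_lin a x y s :
  tensor_pow (a *: x + y) s = a *: tensor_pow x s + tensor_pow y s.
Proof.
apply/currentP => k; rewrite current_coefD [current_coef (_ *: _) k]current_coefZ.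
by rewrite !current_coef_tensor; case: eqP => // _; rewrite scaler0 addr0.
Qed.

Fact current_lie_linl a p q r :
  current_lie (a *: p + q) r = a *: current_lie p r + current_lie q r.
Proof.
pose d := (msupp p `|` msupp q `|` msupp (a *: p + q : current L))%fset.
have lep : (msupp p `<=` d)%fset by rewrite /d -fsetUA fsubsetUl.
have leq : (msupp q `<=` d)%fset by rewrite /d fsetUAC fsubsetUr.
have les : (msupp (a *: p + q : current L) `<=` d)%fset by rewrite /d fsubsetUr.
rewrite (current_lieEw les (fsubset_refl _)) (current_lieEw lep (fsubset_refl _)).
rewrite (current_lieEw leq (fsubset_refl _)) scaler_sumr -big_split /=.
apply: eq_bigr => i _; rewrite scaler_sumr -big_split /=.
apply: eq_bigr => j _; rewrite current_coefD [current_coef (_ *: _) i]current_coefZ.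
by rewrite lie_linl tensor_pow_lin.
Qed.

Fact current_lie_linr a p q r :
  current_lie r (a *: p + q) = a *: current_lie r p + current_lie r q.
Proof.
pose d := (msupp p `|` msupp q `|` msupp (a *: p + q : current L))%fset.
have lep : (msupp p `<=` d)%fset by rewrite /d -fsetUA fsubsetUl.
have leq : (msupp q `<=` d)%fset by rewrite /d fsetUAC fsubsetUr.
have les : (msupp (a *: p + q : current L) `<=` d)%fset by rewrite /d fsubsetUr.
rewrite (current_lieEw (fsubset_refl _) les) (current_lieEw (fsubset_refl _) lep).
rewrite (current_lieEw (fsubset_refl _) leq) scaler_sumr -big_split /=.
apply: eq_bigr => i _; rewrite scaler_sumr -big_split /=.
apply: eq_bigr => j _; rewrite current_coefD [current_coef (_ *: _) j]current_coefZ.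
by rewrite lie_linr tensor_pow_lin.
Qed.

Lemma current_lieDl p q r : current_lie (p + q) r = current_lie p r + current_lie q r.
Proof. by rewrite -[p]scale1r current_lie_linl !scale1r. Qed.

Lemma current_lieDr p q r : current_lie r (p + q) = current_lie r p + current_lie r q.
Proof. by rewrite -[p]scale1r current_lie_linr !scale1r. Qed.

Lemma current_lie0l p : current_lie 0 p = 0.
Proof. by rewrite /current_lie msupp0 big_seq_fset0. Qed.

Lemma current_lie0r p : current_lie p 0 = 0.
Proof. by rewrite /current_lie big1 // => i _; rewrite msupp0 big_seq_fset0. Qed.

Lemma current_lie_tensor x y i j :
  current_lie (tensor_pow x i) (tensor_pow y j) = tensor_pow (lie x y) (i + j).
Proof.
rewrite (current_lieEw (d1 := [fset i]%fset) (d2 := [fset j]%fset)) ?msuppU_le //.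
by rewrite !big_seq_fset1 !current_coef_tensor !eqxx.
Qed.

Lemma current_ind (P : current L -> Prop) :
  P 0 -> (forall p q, P p -> P q -> P (p + q)) ->
  (forall x s, P (tensor_pow x s)) -> forall p, P p.
Proof.
by move=> P0 PD Pt p; rewrite (monalgE p); apply: big_ind => // s _; apply: Pt.
Qed.

Lemma lieC (x y : L) : lie x y = - lie y x.
Proof.
have lDl (u v w : L) : lie (u + v) w = lie u w + lie v w.
  by rewrite -[u]scale1r lie_linl !scale1r.
have lDr (u v w : L) : lie w (u + v) = lie w u + lie w v.
  by rewrite -[u]scale1r lie_linr !scale1r.
have /eqP := liexx (x + y); rewrite lDl !lDr !liexx add0r addr0 addr_eq0.
by move/eqP.
Qed.

Lemma tensor_powN x s : tensor_pow (- x) s = - tensor_pow x s.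
Proof. exact: monalgUN. Qed.

Lemma current_lieC p q : current_lie p q = - current_lie q p.
Proof.
elim/current_ind: p => [|p1 p2 IH1 IH2|x s].
- by rewrite current_lie0l current_lie0r oppr0.
- by rewrite current_lieDl current_lieDr opprD IH1 IH2.
elim/current_ind: q => [|p1 p2 IH1 IH2|y k].
- by rewrite current_lie0l current_lie0r oppr0.
- by rewrite current_lieDl current_lieDr opprD IH1 IH2.
by rewrite !current_lie_tensor -tensor_powN -lieC addnC.
Qed.

Fact current_liexx p : current_lie p p = 0.
Proof.
elim/current_ind: p => [|p q IHp IHq|x s]; first exact: current_lie0l.
  by rewrite current_lieDl !current_lieDr IHp IHq add0r addr0 current_lieC addNr.
by rewrite current_lie_tensor liexx tensor_pow0.
Qed.

Fact current_jacobi p q r :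
  current_lie p (current_lie q r) + current_lie q (current_lie r p)
  + current_lie r (current_lie p q) = 0.
Proof.
have sum6 (a b c a' b' c' : current L) : a + b + c = 0 -> a' + b' + c' = 0 ->
    (a + a') + (b + b') + (c + c') = 0.
  by move=> e e'; rewrite [_ + (b + b')]addrACA [LHS]addrACA e e' addr0.
elim/current_ind: p => [|p p' IH IH'|x i].
- by rewrite !(current_lie0l, current_lie0r) !addr0.
- by rewrite !(current_lieDl, current_lieDr); apply: sum6.
elim/current_ind: q => [|q q' IH IH'|y j].
- by rewrite !(current_lie0l, current_lie0r) !addr0.
- by rewrite !(current_lieDl, current_lieDr); apply: sum6.
elim/current_ind: r => [|r r' IH IH'|z k].
- by rewrite !(current_lie0l, current_lie0r) !addr0.
- by rewrite !(current_lieDl, current_lieDr); apply: sum6.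
rewrite !current_lie_tensor.
have -> : (j + (k + i))%N = (i + (j + k))%N.
  by rewrite [RHS]addnCA [(i + k)%N]addnC.
have -> : (k + (i + j))%N = (i + (j + k))%N by rewrite addnC -addnA.
by rewrite -!tensor_powD lie_jacobi tensor_pow0.
Qed.

HB.instance Definition _ := Lmodule_isLie.Build K (current L)
  current_lie_linl current_lie_linr current_liexx current_jacobi.

(* [a[t]], for a subspace [a] of [L]. *)
Definition sub_current (a : L -> Prop) p : Prop := forall s, a (current_coef p s).

End Current.

Section Roots.
Context (K : fieldType) (g : finLieAlgType K).

Definition is_ideal (I : {vspace g}) : Prop :=
  forall x y : g, y \in I -> lie x y \in I.

Definition simple_lie : Prop :=
  (exists x y : g, lie x y != 0) /\
  (forall I : {vspace g}, is_ideal I -> I = 0%VS \/ I = fullv).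

Definition ad_diagonalizable (x : g) : Prop :=
  exists b : seq g, basis_of fullv b /\
    forall v, v \in b -> exists c : K, lie x v = c *: v.

(* The definition of a Cartan subalgebra of a complex semisimple Lie algebra *)
(* as a toral subalgebra equal to its own centralizer.                       *)
Definition is_cartan (h : {vspace g}) : Prop :=
  [/\ forall x y, x \in h -> y \in h -> lie x y = 0,
      forall x, x \in h -> ad_diagonalizable x
    & forall x, (forall y, y \in h -> lie y x = 0) -> x \in h].

Definition weight (h : {vspace g}) := 'Hom(subvs_of h, K^o).

Definition root_space (h : {vspace g}) (a : weight h) (x : g) : Prop :=
  forall H : subvs_of h, lie (vsval H) x = (a H : K) *: x.

Definition is_root (h : {vspace g}) (a : weight h) : Prop :=
  a != 0 /\ exists x, x != 0 /\ root_space a x.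

Definition nat_comb (h : {vspace g}) n (al : 'I_n -> weight h) (a : weight h) :
    Prop :=
  exists c : 'I_n -> nat, a = \sum_(i < n) al i *+ c i.

Definition is_base (h : {vspace g}) n (al : 'I_n -> weight h) : Prop :=
  [/\ forall i, is_root (al i),
      free [seq al i | i : 'I_n]
    & forall a, is_root a -> nat_comb al a \/ nat_comb al (- a)].

Definition positive_root (h : {vspace g}) n (al : 'I_n -> weight h)
    (a : weight h) : Prop :=
  is_root a /\ nat_comb al a.

(* These relations determine [ha]: as [a ha = 2], it is the coroot of [a],   *)
(* the unique element of [[g_a, g_{-a}]] on which [a] takes the value 2.     *)
Definition root_triple (h : {vspace g}) (a : weight h) (ha : subvs_of h)
    (xp xm : g) : Prop :=
  [/\ xp != 0 /\ root_space a xp, xm != 0 /\ root_space (- a) xm,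
      lie (vsval ha) xp = 2 *: xp, lie (vsval ha) xm = - (2 *: xm)
    & lie xp xm = vsval ha].

(* Only the values of [coroot], [xplus], [xminus] at positive roots matter.  *)
Record root_data := RootData {
  cartan : {vspace g};
  rank : nat;
  simple_root : 'I_rank -> weight cartan;
  coroot : weight cartan -> subvs_of cartan;
  xplus : weight cartan -> g;
  xminus : weight cartan -> g;
  cartanP : is_cartan cartan;
  simple_rootP : is_base simple_root;
  root_tripleP : forall a, positive_root simple_root a ->
    root_triple a (coroot a) (xplus a) (xminus a)
}.

End Roots.

Section Modules.
Context (K : fieldType) (g : finLieAlgType K) (D : root_data g).

(* A [g[t]]-module is a left module over [U].                                *)
Local Notation U := (envel (current g)).

Definition pos_root (a : weight (cartan D)) : Prop :=
  positive_root (@simple_root _ _ D) a.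

Definition coroot_s (i : 'I_(rank D)) := coroot (simple_root i).
Definition xplus_s (i : 'I_(rank D)) : g := xplus (simple_root i).
Definition xminus_s (i : 'I_(rank D)) : g := xminus (simple_root i).

Definition nplus : g -> Prop :=
  submod_gen (fun y => exists a, pos_root a /\ root_space a y).

Definition dominant (lam : weight (cartan D)) : Prop :=
  forall i, exists m : nat, lam (coroot_s i) = m%:R.

(* The image of [x (x) t^s] in [U(g[t])]. *)
Definition ut (x : g) (s : nat) : U := envel_in (tensor_pow x s).

Definition div_pow (u : U) (p : nat) : U := (p`!%:R : K)^-1 *: u ^+ p.

(* The element [_k x(r,s)]: the conditions on [(b_p)] force [b_p <= r], and [b_p = 0]    *)
(* for [p > s].                                                              *)
Definition kx (x : g) (k r s : nat) : U :=
  \sum_(b : {ffun 'I_s.+1 -> 'I_r.+1} |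
          [&& [forall p : 'I_s.+1, (p < k)%N ==> (b p == 0%N :> nat)],
              (\sum_(p < s.+1) b p)%N == r
            & (\sum_(p < s.+1) p * b p)%N == s])
    \prod_(p < s.+1 | (k <= p)%N) div_pow (ut x p) (b p).

Section LocalWeyl.
Variable lam : weight (cartan D).

Inductive local_weyl_rel : U^o -> Prop :=
| local_weyl_plus i (p : current g) :
    sub_current (fun y => y \in <[xplus_s i]>%VS) p ->
    local_weyl_rel (envel_in p)
| local_weyl_cartan i s :
    local_weyl_rel
      (ut (vsval (coroot_s i)) s - ((lam (coroot_s i) : K) * (s == 0%N)%:R)%:A)
| local_weyl_minus i (m : nat) :
    lam (coroot_s i) = m%:R ->
    local_weyl_rel (ut (xminus_s i) 0 ^+ m.+1).

Definition local_weyl : lmodType U := quot_module local_weyl_rel.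
Definition w_gen : local_weyl := quot_module_pi local_weyl_rel 1.

(* The partition of a positive root [a] is the nonincreasing sequence [xi a] *)
(* (trailing zeros are allowed and play no role); [sumn (drop k (xi a))] is  *)
(* the sum of its parts of (1-based) index at least [k + 1].                 *)
Definition compatible (xi : weight (cartan D) -> seq nat) : Prop :=
  forall a, pos_root a ->
    sorted geq (xi a) /\ (sumn (xi a))%:R = (lam (coroot a) : K).

Variable xi : weight (cartan D) -> seq nat.

Inductive V_xi_rel : local_weyl -> Prop :=
| V_xi_relI a (s r k : nat) :
    pos_root a -> (0 < s)%N -> (0 < r)%N -> (0 < k)%N ->
    (1 + r * k + sumn (drop k (xi a)) <= s + r)%N ->
    V_xi_rel ((ut (xplus a) 1 ^+ s * ut (xminus a) 0 ^+ (s + r)) *: w_gen).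

Definition V_xi : lmodType U := quot_module V_xi_rel.
Definition v_gen : V_xi := quot_module_pi V_xi_rel w_gen.

Inductive V_xi_defining_rel : U^o -> Prop :=
| V_xi_plus (p : current g) :
    sub_current nplus p -> V_xi_defining_rel (envel_in p)
| V_xi_cartan (H : subvs_of (cartan D)) s :
    V_xi_defining_rel (ut (vsval H) s - ((s == 0%N)%:R * (lam H : K))%:A)
| V_xi_minus i (m : nat) :
    lam (coroot_s i) = m%:R ->
    V_xi_defining_rel (ut (xminus_s i) 0 ^+ m.+1)
| V_xi_kx a (s r k : nat) :
    pos_root a -> (0 < s)%N -> (0 < r)%N -> (0 < k)%N ->
    (1 + k * r + sumn (drop k (xi a)) <= s + r)%N ->
    V_xi_defining_rel (kx (xminus a) k r s).

End LocalWeyl.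
End Modules.

Arguments V_xi_rel {K g D} lam xi _.

(* Main.v *)
(* The relations defining V(xi) and those of the proposition both live on a   *)
(* vector v killed by n+[t] and by h (x) tC[t].  For such a v and a positive  *)
(* root a, Garland's identity expresses (x_a^+ (x) t)^s (x_a^- (x) 1)^(s+r) v *)
(* as a nonzero multiple of x_a^-(r,s) v, where x_a^-(r,s) is the coefficient *)
(* of u^s in the r-th divided power of f(u) = sum_p (x_a^- (x) t^p) u^p.      *)
(* Splitting off the terms of f of degree < k gives                           *)
(*   x(r,s) = sum_(i,j) l(i,j) _kx(r-i,s-j),  l(i,j) = 0 if i + j > k i,      *)
(* a unitriangular system preserving the range s + r >= 1 + k r + c, so that  *)
(* the relations for x(r,s) and for _kx(r,s) on this range are equivalent.    *)
(* Finally, W_loc(lambda) is defined by the Chevalley generators only:        *)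
(* positivity of the Killing form on coroots shows that the x_i^+ generate    *)
(* n+ and that the h_i span h.                                                *)

From HB Require Import structures.
Require Import Defs.
From mathcomp Require Import all_boot all_order all_algebra.
From mathcomp Require Import reals complex ring zify.

Set Implicit Arguments.
Unset Strict Implicit.
Unset Printing Implicit Defensive.

Import Order.TTheory GRing.Theory Num.Theory.
Import VectorInternalTheory.
Local Open Scope ring_scope.

(** * Adjoint matrices and the Killing form *)

(** Both presentations describe a cyclic module, so the claim is an equality of annihilators in
    U(g[t]). One inclusion says that [v_gen] satisfies the new relations ([v_gen_defining_rel]); the
    other says that the generator [q] of U modulo the new relations satisfies the old ones, hence is
    killed by all that kills [v_gen] ([v_gen_annihilator]).

    Two gaps separate the lists. The first is that the local Weyl module only speaks of simple root
    vectors and simple coroots. For each positive root, sl2 theory makes the eigenvalues of ad h_a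
    real, so the Killing form is positive on h_a. This yields, for every positive root b, a simple
    coroot on which b is positive, and so a descent b, b - a_j, ... showing that the x_j^+ generate
    n^+ ([simple_roots_generate]). Positivity also makes the simple coroots independent; simplicity
    of g bounds dim h by the rank, so they span h ([coroot_span]).

    The second gap is between (x^+ t)^s (x^-)^(s+r) and _kx^-(r,s). Put f(u) = sum_p (x^- t^p) u^p
    and E = x^+ t. If E and all h t^(i+1) kill v, then E f^(r+1) v = -(r+1) (f^r)' v. Iterating on
    the constant coefficient x_0^(s+r) of f^(s+r) gives a nonzero multiple of the u^s-coefficient of
    f^r, which is r! x^-(r,s) ([garland]). Writing f as its part of degree below k plus the rest
    relates x^-(r,s) to _kx^-(r,s) by a triangular system ([dpow_sum_annihilated]). The last
    assertion is the case s = kr, where a single monomial survives. *)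

Section LieBilinear.
Context (K : fieldType) (L : lieAlgType K).
Implicit Types x y z : L.

HB.instance Definition _ x :=
  GRing.isLinear.Build K L L _ (lie x) (fun a y z => lie_linr a y z x).

Lemma lieDl x y z : lie (x + y) z = lie x z + lie y z.
Proof. by rewrite -[x in LHS]scale1r lie_linl scale1r. Qed.

Lemma lieZl a x z : lie (a *: x) z = a *: lie x z.
Proof. by rewrite -[a *: x]addr0 lie_linl lie0l addr0. Qed.

Lemma lie_lie x y z : lie (lie x y) z = lie x (lie y z) - lie y (lie x z).
Proof.
rewrite (lieC (lie x y) z); apply/eqP; rewrite eq_sym -subr_eq0 opprK.
by rewrite (lieC x z) raddfN opprK lie_jacobi.
Qed.

End LieBilinear.

Section AdjointMatrix.
Context (K : fieldType) (g : finLieAlgType K).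
Implicit Types x y z : g.

(** Matrices act on row vectors from the right, so [ad_mx] reverses products; this is the sign in
    [ad_mx_lie]. *)
Definition ad_mx x : 'M[K]_(dim g) := lin1_mx (v2r \o lie x \o r2v).

Lemma v2r_ad_mx x y : v2r y *m ad_mx x = v2r (lie x y).
Proof. by rewrite mul_rV_lin1 /= v2rK. Qed.

Lemma ad_mx_eq x (A : 'M[K]_(dim g)) :
  (forall y, v2r (lie x y) = v2r y *m A) -> ad_mx x = A.
Proof.
move=> xA; apply/row_matrixP => i; rewrite !rowE -[delta_mx 0 i]r2vK.
by rewrite v2r_ad_mx xA.
Qed.

Fact ad_mx_is_linear : linear ad_mx.
Proof.
move=> a x y; apply: ad_mx_eq => z.
by rewrite lie_linl linearP mulmxDr -scalemxAr !v2r_ad_mx.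
Qed.
HB.instance Definition _ :=
  GRing.isLinear.Build K g 'M[K]_(dim g) _ ad_mx ad_mx_is_linear.

Lemma ad_mx_lie x y : ad_mx (lie x y) = ad_mx y *m ad_mx x - ad_mx x *m ad_mx y.
Proof.
by apply: ad_mx_eq => z; rewrite mulmxBr !mulmxA !v2r_ad_mx lie_lie linearB.
Qed.

Definition killing x y : K := \tr (ad_mx x *m ad_mx y).

Lemma killingC x y : killing x y = killing y x.
Proof. exact: mxtrace_mulC. Qed.

Lemma killingZr a x y : killing x (a *: y) = a * killing x y.
Proof. by rewrite /killing linearZ -scalemxAr mxtraceZ. Qed.

Lemma killing_sumr I (r : seq I) x (F : I -> g) :
  killing x (\sum_(i <- r) F i) = \sum_(i <- r) killing x (F i).
Proof. by rewrite /killing linear_sum mulmx_sumr linear_sum. Qed.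

Lemma killing_lie x y z : killing (lie x y) z = killing x (lie y z).
Proof.
rewrite /killing !ad_mx_lie mulmxBl mulmxBr !raddfB /= mxtrace_mulC !mulmxA.
congr (_ - _); rewrite -[RHS]mxtrace_mulC !mulmxA -[RHS]mxtrace_mulC.
by rewrite !mulmxA.
Qed.

Lemma ad_mx_eigenvalue x y (c : K) :
  y != 0 -> lie x y = c *: y -> eigenvalue (ad_mx x) c.
Proof.
move=> y0 xy; apply/eigenvalueP; exists (v2r y).
  by rewrite v2r_ad_mx xy linearZ.
by rewrite -(inj_eq (can_inj v2rK)) linear0 in y0 *.
Qed.

(** Otherwise the characteristic polynomial of ad x would have more than [dim g] distinct roots. *)
Lemma eigenvector_sequence_vanishes x (c : nat -> K) (v : nat -> g) :
  injective c -> (forall n, lie x (v n) = c n *: v n) -> exists n, v n == 0.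
Proof.
move=> c_inj xv.
have [/hasP[n _ vn0]|/hasPn v_neq0] :=
    boolP (has (fun n => v n == 0) (iota 0 (dim g).+1)); first by exists n.
have rc : all (root (char_poly (ad_mx x))) (map c (iota 0 (dim g).+1)).
  apply/allP => _ /mapP[n n_in ->]; rewrite -eigenvalue_root_char.
  exact: ad_mx_eigenvalue (v_neq0 n n_in) (xv n).
have := max_poly_roots (monic_neq0 (char_poly_monic (ad_mx x))) rc.
rewrite map_inj_uniq // iota_uniq size_map size_iota size_char_poly.
by rewrite ltnn => /(_ isT).
Qed.

End AdjointMatrix.

(** * Finite-dimensional representations of sl2 *)

Section SL2.
Context (C : numClosedFieldType) (g : finLieAlgType C).
Context (e f h : g).
Hypotheses (he : lie h e = 2 *: e) (hf : lie h f = - (2 *: f))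
  (ef : lie e f = h).
Implicit Types (y : g) (m : C).

Lemma iter_raising_weight y m n : lie h y = m *: y ->
  lie h (iter n (lie e) y) = (m + n.*2%:R) *: iter n (lie e) y.
Proof.
move=> hy; elim: n => [|n IH] /=; first by rewrite addr0.
have -> : lie h (lie e (iter n (lie e) y)) =
    lie (lie h e) (iter n (lie e) y) + lie e (lie h (iter n (lie e) y)).
  by rewrite lie_lie subrK.
rewrite he IH lieZl linearZ /= -scalerDl doubleS.
by congr (_ *: _); ring.
Qed.

Lemma iter_lowering_weight y m n : lie h y = m *: y ->
  lie h (iter n (lie f) y) = (m - n.*2%:R) *: iter n (lie f) y.
Proof.
move=> hy; elim: n => [|n IH] /=; first by rewrite subr0.
have -> : lie h (lie f (iter n (lie f) y)) =
    lie (lie h f) (iter n (lie f) y) + lie f (lie h (iter n (lie f) y)).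
  by rewrite lie_lie subrK.
rewrite hf IH -scaleNr lieZl linearZ /= -scalerDl doubleS.
by congr (_ *: _); ring.
Qed.

Lemma add_double_inj m : injective (fun n : nat => m + n.*2%:R).
Proof. by move=> i j /addrI/eqP; rewrite eqr_nat => /eqP/double_inj. Qed.

Lemma sub_double_inj m : injective (fun n : nat => m - n.*2%:R).
Proof. by move=> i j /addrI/oppr_inj/eqP; rewrite eqr_nat => /eqP/double_inj. Qed.

(* Otherwise the vectors [e^n y] would all be nonzero, since [f] maps        *)
(* [e^(n+1) y] to a strictly negative multiple of [e^n y].                   *)
Lemma raising_lowering_eq0 y m :
  lie h y = m *: y -> 0 < m -> lie e (lie f y) = 0 -> y = 0.
Proof.
move=> hy m_gt0 efy; pose w n := iter n (lie e) y.
have hw n : lie h (w n) = (m + n.*2%:R) *: w n by apply: iter_raising_weight.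
have fw n : exists2 c : C, 0 < c & lie f (w n.+1) = - c *: w n.
  have fe z : lie f (lie e z) = lie e (lie f z) - lie h z.
    by rewrite -ef lie_lie opprB addrC subrK.
  elim: n => [|n [c c_gt0 IH]].
    by exists m; rewrite // /w /= fe efy hy sub0r scaleNr.
  exists (c + (m + n.+1.*2%:R)); first by rewrite !addr_gt0 // ltr0n.
  by rewrite [w n.+2]/(lie e (w n.+1)) fe IH linearZ hw /= -scaleNr -scalerDl -opprD.
have [n] := eigenvector_sequence_vanishes (@add_double_inj m) hw.
elim: n => [/eqP//|n IH /eqP wn0]; apply: IH.
have [c c_gt0 /eqP] := fw n.
by rewrite wn0 raddf0 eq_sym scaler_eq0 oppr_eq0 gt_eqF.
Qed.

(** The last nonzero vector w = e^n y has weight d = m + 2n, and e f^(k+1) w = (k+1)(d-k) f^k w. At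
    the first k with f^(k+1) w = 0 this forces d = k, so m = k - 2n. *)
Lemma sl2_weight_real y m : y != 0 -> lie h y = m *: y -> m \is Num.real.
Proof.
move=> y0 hy.
have ex_n := eigenvector_sequence_vanishes (@add_double_inj m)
  (fun n => iter_raising_weight n hy).
case: (ex_minnP ex_n) => -[|n] /eqP wn0 n_min.
  by move: wn0 y0 => /= ->; rewrite eqxx.
set w := iter n (lie e) y; pose d := m + n.*2%:R.
have w_neq0 : w != 0 by apply/negP => /n_min; rewrite ltnn.
have ew : lie e w = 0 by [].
have hw : lie h w = d *: w by apply: iter_raising_weight.
pose u k := iter k (lie f) w.
have hu k : lie h (u k) = (d - k.*2%:R) *: u k by apply: iter_lowering_weight.
have eu k : lie e (u k.+1) = (k.+1%:R * (d - k%:R)) *: u k.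
  have efz z : lie e (lie f z) = lie f (lie e z) + lie h z.
    by rewrite -ef lie_lie addrC subrK.
  elim: k => [|k IH]; first by rewrite efz ew raddf0 add0r hw mul1r subr0.
  rewrite [u k.+2]/(lie f (u k.+1)) efz IH hu linearZ /= -scalerDl.
  by congr (_ *: _); rewrite -muln2; ring.
have ex_k := eigenvector_sequence_vanishes (@sub_double_inj d) hu.
case: (ex_minnP ex_k) => -[|k] /eqP uk0 k_min; 
  first by move: uk0 w_neq0; rewrite /u /= => ->; rewrite eqxx.
have /eqP := eu k; rewrite uk0 raddf0 eq_sym scaler_eq0 mulf_eq0 pnatr_eq0 /=.
case/orP=> [|/k_min]; last by rewrite ltnn.
rewrite subr_eq0 => /eqP dk.
have -> : m = k%:R - n.*2%:R by rewrite -dk /d addrK.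
by rewrite rpredB ?realn.
Qed.

End SL2.

(** In an eigenbasis the value is the sum of the squares of the real eigenvalues of ad x, and these
    are not all zero. *)
Lemma killing_diag_gt0 (C : numClosedFieldType) (g : finLieAlgType C) (x y : g) :
  ad_diagonalizable x ->
  (forall z c, z != 0 -> lie x z = c *: z -> c \is Num.real) ->
  lie x y != 0 -> 0 < killing x x.
Proof.
move=> [b [b_basis xb]] real_ev xy0.
have b_size : size b == dim g by rewrite -dimvf (size_basis (X := in_tuple b) b_basis).
pose t := Tuple b_size.
have b_free : free t by apply: basis_free b_basis.
have [d xt] : exists d : 'I_(dim g) -> C, forall i, lie x (tnth t i) = d i *: tnth t i.
  apply: (@fin_all_exists _ _ (fun i c => lie x (tnth t i) = c *: tnth t i)) => i.
  exact/xb/mem_tnth.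
have d_real i : d i \is Num.real.
  by apply: real_ev (xt i); apply: (free_not0 b_free); apply: mem_tnth.
pose P : 'M[C]_(dim g) := \matrix_(i < dim g) v2r (tnth t i).
pose S := diag_mx (\row_i d i).
have PA : P *m ad_mx x = S *m P.
  apply/row_matrixP => i; rewrite row_mul rowK v2r_ad_mx xt linearZ /=.
  by apply/rowP => j; rewrite mul_diag_mx !mxE.
have P_unit : P \in unitmx.
  rewrite -row_free_unit; apply: inj_row_free => v vP0.
  apply/rowP => i; rewrite mxE; move: i; have /freeP/(_ (v 0)) := b_free; apply.
  apply: (can_inj v2rK); rewrite linear0 -vP0 mulmx_sum_row linear_sum.
  by apply: eq_bigr => i _; rewrite linearZ rowK /= (tnth_nth 0).
have xE : ad_mx x = invmx P *m S *m P by rewrite -mulmxA -PA mulKmx.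
have -> : killing x x = \sum_i d i ^+ 2.
  rewrite /killing mxtrace_mulC {1}xE -!mulmxA PA mxtrace_mulC -!mulmxA mulmxV //.
  rewrite mulmx1 /mxtrace; apply: eq_bigr => i _.
  by rewrite mul_diag_mx !mxE eqxx mulr1n expr2.
have ge0 i : 0 <= d i ^+ 2 by rewrite real_exprn_even_ge0.
rewrite lt0r sumr_ge0 // andbT psumr_neq0 //.
have : ad_mx x != 0.
  apply: contraNneq xy0 => x0.
  by rewrite -[lie x y]v2rK -v2r_ad_mx x0 mulmx0 linear0.
apply: contraNT => /hasPn d0; rewrite xE.
suff -> : S = 0 by rewrite mulmx0 mul0mx.
apply/matrixP => i j; rewrite !mxE; apply/eqP; rewrite mulrn_eq0; apply/orP; right.
by have := d0 i (mem_index_enum i); rewrite /= lt0r ge0 andbT negbK sqrf_eq0.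
Qed.

(** Each B commutes with A, hence preserves the eigenspace; the commuting restrictions have a common
    eigenvector there. *)
Lemma common_eigenvector_in_eigenspace (C : numClosedFieldType) n
    (A : 'M[C]_n) (a : C) (Bs : seq 'M[C]_n) :
  eigenvalue A a -> {in Bs, forall B, comm_mx A B} ->
  {in Bs &, forall B B', comm_mx B B'} ->
  exists v : 'rV_n, [/\ v != 0, (v <= eigenspace A a)%MS
    & {in Bs, forall B, stablemx v B}].
Proof.
move=> a_eigen AB_comm B_comm; pose E := eigenspace A a.
have stabE B : B \in Bs -> stablemx E B.
  by move=> /AB_comm; apply: comm_mx_stable_eigenspace.
have [||v v0 /allP vP] := @common_eigenvector _ _ [seq restrictmx E B | B <- Bs].
- by rewrite lt0n mxrank_eq0.
- move=> _ _ /mapP[B Bin ->] /mapP[B' B'in ->].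
  rewrite /comm_mx -!conjmxM ?inE ?stablemx_row_base ?stabE //.
  by rewrite (B_comm B B').
exists (v *m row_base E); split.
- by rewrite mulmx_free_eq0 ?row_base_free.
- by rewrite mulmx_sub // eq_row_base.
by move=> B Bin; rewrite -stablemx_restrict ?stabE // vP // map_f.
Qed.

(** * Root spaces *)

Section RootData.
Context (C : numClosedFieldType) (g : finLieAlgType C) (D : root_data g).
Implicit Types (a b : weight (cartan D)) (H : subvs_of (cartan D)).

Lemma weight_sumE n (al : 'I_n -> weight (cartan D)) (c : 'I_n -> nat) H :
  ((\sum_i al i *+ c i) H : C) = \sum_i (al i H : C) *+ c i.
Proof.
rewrite sum_lfunE; apply: eq_bigr => i _.
by elim: (c i) => [|n' IH]; rewrite ?mulr0n ?zero_lfunE // !mulrS add_lfunE IH.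
Qed.

Lemma simple_root_pos i : pos_root (@simple_root _ _ D i).
Proof.
have [al_root _ _] := simple_rootP D; split; first exact: al_root.
exists (fun j => (j == i) : nat); rewrite (bigD1 i) //= eqxx mulr1n big1 ?addr0 //.
by move=> j /negPf ->.
Qed.

Lemma coroot_value a : pos_root a -> a (coroot a) = 2 :> C.
Proof.
move=> /root_tripleP [[xp0 xpR] _ hxp _ _]; apply/eqP; rewrite -subr_eq0.
have /eqP : (a (coroot a) - 2 : C) *: xplus a = 0.
  by rewrite scalerBl -(xpR (coroot a)) hxp subrr.
by rewrite scaler_eq0 (negPf xp0) orbF.
Qed.

Lemma coroot_weight_real a y (m : C) : pos_root a -> y != 0 ->
  lie (vsval (coroot a)) y = m *: y -> m \is Num.real.
Proof. by move=> /root_tripleP [_ _ he hf ef]; exact: (sl2_weight_real he hf ef). Qed.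

(** Invariance of the form applied to h_a = [x_a^+, x_a^-]. Values of roots thereby become values of
    the Killing form. *)
Lemma killing_coroot a H : pos_root a ->
  killing (vsval (coroot a)) (vsval H) =
    (a H : C) * killing (xplus a) (xminus a).
Proof.
move=> /root_tripleP [_ [_ xmR] _ _ <-].
by rewrite killing_lie lieC xmR opp_lfunE scaleNr opprK killingZr.
Qed.

Lemma killing_root_vectors_gt0 a : pos_root a -> 0 < killing (xplus a) (xminus a).
Proof.
move=> a_pos; have [[xp0 _] _ he hf ef] := root_tripleP a_pos.
have : 0 < killing (vsval (coroot a)) (vsval (coroot a)).
  have [_ diag _] := cartanP D.
  apply: (@killing_diag_gt0 _ _ _ (xplus a)); first exact/diag/subvsP.
    by move=> z c; apply: coroot_weight_real.
  by rewrite he scaler_eq0 (negPf xp0) orbF pnatr_eq0.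
by rewrite killing_coroot // coroot_value // pmulr_rgt0 // ltr0n.
Qed.

(* Both sides of [b (h_j) (x_b^+, x_b^-) = a_j (h_b) (x_j^+, x_j^-)] equal   *)
(* [(h_b, h_j)], so that [b (h_j)] has the sign of [a_j (h_b)], and          *)
(* [2 = b (h_b)] is a nonnegative combination of the latter.                 *)
Lemma exists_simple_coroot_gt0 b : pos_root b ->
  exists j, 0 < (b (coroot_s j) : C).
Proof.
move=> b_pos; have [_ [c bE]] := b_pos.
pose v j : C := simple_root j (coroot b).
have v_real j : v j \is Num.real.
  have [[x0 xR] _ _ _ _] := root_tripleP (simple_root_pos j).
  by apply: coroot_weight_real b_pos x0 _; rewrite xR.
have [j vj_gt0] : exists j, 0 < v j.
  apply/existsP; apply: contraT; rewrite negb_exists => /forallP v_le0.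
  have : (b (coroot b) : C) <= 0.
    rewrite {1}bE weight_sumE sumr_le0 // => j _; rewrite mulrn_wle0 //.
    by have := v_le0 j; rewrite -real_leNgt ?real0.
  by rewrite coroot_value // lern0.
exists j.
rewrite -(pmulr_lgt0 _ (killing_root_vectors_gt0 b_pos)) -killing_coroot //.
rewrite killingC killing_coroot ?pmulr_lgt0 //; last exact: simple_root_pos.
exact/killing_root_vectors_gt0/simple_root_pos.
Qed.

Lemma root_space_lie a b x y :
  root_space a x -> root_space b y -> root_space (a + b) (lie x y).
Proof.
move=> xa yb H; have -> : lie (vsval H) (lie x y) =
    lie (lie (vsval H) x) y + lie x (lie (vsval H) y) by rewrite lie_lie subrK.
by rewrite xa yb lieZl linearZ /= -scalerDl add_lfunE.
Qed.

(** Since [x_a^-, y] centralizes h, it lies in h; subtracting a suitable multiple of x_a^+ from y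
    then gives a vector to which [raising_lowering_eq0] applies with weight 2. *)
Lemma root_space_line a y : pos_root a -> root_space a y -> y \in <[xplus a]>%VS.
Proof.
move=> a_pos yR; have [[xp0 xpR] [xm0 xmR] he hf ef] := root_tripleP a_pos.
have [_ _ cent] := cartanP D.
have [H0 fyE] : exists H0 : subvs_of (cartan D), vsval H0 = lie (xminus a) y.
  suff fyH : lie (xminus a) y \in cartan D by exists (Subvs fyH).
  apply: cent => z zH.
  have := root_space_lie xmR yR (Subvs zH).
  by rewrite addNr zero_lfunE scale0r.
(* The value for which [x_a^+, [x_a^-, y']] = (2c - a(H0)) x_a^+ vanishes. *)
pose c : C := a H0 / 2.
pose y' := y + c *: xplus a.
have hy' : lie (vsval (coroot a)) y' = 2 *: y'.
  by rewrite linearD linearZ /= he yR coroot_value // scalerDr !scalerA mulrC.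
have fy' : lie (xminus a) y' = vsval H0 - c *: vsval (coroot a).
  by rewrite linearD linearZ /= -fyE (lieC (xminus a) (xplus a)) ef scalerN.
have y'0 : y' = 0.
  apply: (raising_lowering_eq0 he ef hy'); first by rewrite ltr0n.
  rewrite fy' linearB linearZ /= !(lieC (xplus a)) he xpR.
  rewrite scalerN scalerA divfK ?pnatr_eq0 // opprK.
  by rewrite addrC subrr.
have -> : y = - c *: xplus a by apply/eqP; rewrite scaleNr -addr_eq0; apply/eqP.
exact/rpredZ/memv_line.
Qed.

Lemma simple_roots_free (c : 'I_(rank D) -> C) :
  \sum_i c i *: @simple_root _ _ D i = 0 -> forall i, c i = 0.
Proof.
have [_ al_free _] := simple_rootP D => c0.
have /freeP/(_ c) : free [tuple @simple_root _ _ D i | i < rank D] by [].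
by apply; rewrite -[RHS]c0; apply: eq_bigr => i _; rewrite -tnth_nth tnth_mktuple.
Qed.

Lemma simple_root_comb_inj (c c' : 'I_(rank D) -> nat) :
  \sum_i @simple_root _ _ D i *+ c i = \sum_i @simple_root _ _ D i *+ c' i ->
  c =1 c'.
Proof.
move=> cc' i; apply/eqP; rewrite -(eqr_nat C) -subr_eq0; apply/eqP; move: i.
apply: simple_roots_free; transitivity
  (\sum_i @simple_root _ _ D i *+ c i - \sum_i @simple_root _ _ D i *+ c' i).
  by rewrite -sumrB; apply: eq_bigr => i _; rewrite scalerBl !scaler_nat.
by rewrite cc' subrr.
Qed.

(** * Generation of the positive part by simple root vectors *)

Section Generation.
Context (S : g -> Prop).
Hypotheses (S_lin : forall (c : C) x y, S x -> S y -> S (c *: x + y))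
  (S0 : S 0) (S_lie : forall x y, S x -> S y -> S (lie x y))
  (S_simple : forall i, S (xplus_s (D := D) i)).

Lemma S_scale (c : C) x : S x -> S (c *: x).
Proof. by move=> Sx; rewrite -[c *: x]addr0; apply: S_lin. Qed.

(* Some [b - a_j] is a root, and [x_b^+] is proportional to the bracket of   *)
(* [x_j^+] with a root vector for it: induction on the height of [b].        *)
Lemma simple_roots_generate b y : pos_root b -> root_space b y -> S y.
Proof.
move=> b_pos; have [_ [c bE]] := b_pos.
have [n] := ubnP (\sum_i c i)%N; elim: n => // n IH in b b_pos c bE y *.
rewrite ltnS => c_le yR.
have /vlineP[k ->] := root_space_line b_pos yR.
apply: S_scale => {y k yR}.
have [[x0 xR] _ _ _ _] := root_tripleP b_pos.
have [j j_gt0] := exists_simple_coroot_gt0 b_pos.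
have [->|b_neq] := eqVneq b (simple_root j); first exact: S_simple.
have [[_ xpR] [_ xmR] he hf ef] := root_tripleP (simple_root_pos j).
pose y := lie (xminus_s j) (xplus b).
have yR : root_space (b - simple_root j) y by rewrite addrC; apply: root_space_lie.
(* For the sl2 of the j-th simple root, x_b^+ has positive weight b(h_j); if the bracket vanished,
   [raising_lowering_eq0] would give x_b^+ = 0. *)
have xy0 : lie (xplus_s j) y != 0.
  apply: contraNneq x0 => xy0.
  by rewrite (raising_lowering_eq0 he ef (xR (coroot_s j)) j_gt0 xy0).
have [k ->] : exists k, xplus b = k *: lie (xplus_s j) y.
  have xyR : root_space b (lie (xplus_s j) y).
    by have := root_space_lie xpR yR; rewrite addrCA subrr addr0.
  have /vlineP[k xyE] := root_space_line b_pos xyR.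
  have k_neq0 : k != 0 by apply: contraNneq xy0 => k0; rewrite xyE k0 scale0r.
  by exists k^-1; rewrite xyE scalerA mulVf // scale1r.
apply: S_scale.
have bj_root : is_root (b - simple_root j).
  split; first by rewrite subr_eq0.
  by exists y; split=> //; apply: contraNneq xy0 => ->; rewrite raddf0.
have alE : @simple_root _ _ D j = \sum_i @simple_root _ _ D i *+ (i == j).
  by rewrite (bigD1 j) //= eqxx mulr1n big1 ?addr0 // => i /negPf ->.
have [_ _ base] := simple_rootP D.
(* If a_j - b were a nonnegative combination, then c + c' would be the indicator of j, so b = c_j
   a_j with c_j at most 1, that is b = 0 or b = a_j; both are excluded. *)
case: (base _ bj_root) => [[c' c'E]|[c' c'E]]; last first.
  have cE : (fun i => c i + c' i)%N =1 (fun i => i == j : nat).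
    apply: simple_root_comb_inj; rewrite -alE; under eq_bigr do rewrite mulrnDr.
    by rewrite big_split /= -bE -c'E opprB addrCA subrr addr0.
  have bcj : b = simple_root j *+ c j.
    rewrite bE (bigD1 j) //= big1 ?addr0 // => i /negPf i_neq.
    by have /eqP := cE i; rewrite /= i_neq addn_eq0 => /andP[/eqP-> _].
  have : (c j <= 1)%N.
    by apply: leq_trans (leq_addr (c' j) (c j)) _; have /= -> := cE j; apply: leq_b1.
  case cj: (c j) => [|[|//]] _; move: bcj; rewrite cj.
    by case: b_pos => [[b0 _] _] b_eq0; rewrite b_eq0 eqxx in b0.
  by rewrite mulr1n => b_eq; rewrite b_eq eqxx in b_neq.
apply: S_lie; first exact: S_simple.
apply: (IH _ (conj bj_root (ex_intro _ c' c'E)) c' c'E y _ yR).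
apply: leq_trans c_le.
have cE : c =1 (fun i => c' i + (i == j))%N.
  apply: simple_root_comb_inj; under [RHS]eq_bigr do rewrite mulrnDr.
  by rewrite big_split /= -bE -alE -c'E subrK.
rewrite (eq_bigr _ (fun i _ => cE i)) big_split /=.
rewrite (bigD1 j (F := fun i => (i == j : nat))) //=.
by rewrite eqxx addnCA add1n leq_addr.
Qed.
End Generation.

(** * The simple coroots span the Cartan subalgebra *)

Section CorootSpan.
Hypothesis g_simple : simple_lie g.

Lemma cartan_comm H H' : lie (vsval H) (vsval H') = 0.
Proof. by have [comm _ _] := cartanP D; apply: comm; apply: subvsP. Qed.

Lemma ad_mx_cartan_comm H H' : comm_mx (ad_mx (vsval H)) (ad_mx (vsval H')).
Proof.
apply/eqP; rewrite -subr_eq0 -ad_mx_lie cartan_comm; apply/eqP/ad_mx_eq => y.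
by rewrite lie0l linear0 mulmx0.
Qed.

(** Since ad h is a commuting family, an eigenspace of ad H contains a simultaneous eigenvector,
    whose weight b (possibly zero) takes the value c at H. *)
Lemma common_root_vector H (c : C) y : y != 0 -> lie (vsval H) y = c *: y ->
  exists b x, [/\ x != 0, root_space b x & b H = c :> C].
Proof.
move=> y0 Hy; pose Bs := [seq ad_mx (vsval H') | H' <- vbasis {:subvs_of (cartan D)}].
have [||v [v0 /eigenspaceP vH vBs]] :=
    @common_eigenvector_in_eigenspace _ _ _ _ Bs (ad_mx_eigenvalue y0 Hy).
- by move=> _ /mapP[H' _ ->]; apply: ad_mx_cartan_comm.
- by move=> _ _ /mapP[H' _ ->] /mapP[H'' _ ->]; apply: ad_mx_cartan_comm.
pose x := r2v v; have vE : v2r x = v := r2vK v.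
have x0 : x != 0 by apply: contraNneq v0; rewrite -vE => ->; rewrite linear0.
have ev H' : exists k : C, lie (vsval H') x = k *: x.
  rewrite (coord_vbasis (memvf H')) linear_sum /=.
  pose P z := exists k : C, lie z x = k *: x.
  apply: (big_ind P) => [|z z' [k zE] [k' z'E]|i _].
  - by exists 0; rewrite lie0l scale0r.
  - by exists (k + k'); rewrite lieDl zE z'E scalerDl.
  have := vBs (ad_mx (vsval (vbasis {:subvs_of (cartan D)})`_i)).
  case/(_ _)/Wrap => [|/sub_rVP[k kE]].
    apply/mapP; exists (vbasis {:subvs_of (cartan D)})`_i => //.
    by apply: mem_nth; rewrite size_tuple.
  exists (coord (vbasis {:subvs_of (cartan D)}) i H' * k).
  rewrite lieZl -scalerA; congr (_ *: _).
  by apply: (can_inj v2rK); rewrite -v2r_ad_mx vE kE linearZ /= vE.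
have [i vi0] : exists i, v 0 i != 0 by apply/rV0Pn.
(* Reading the eigenvalue off a nonzero coordinate of v makes its linearity in H' visible. *)
pose k H' : C^o := v2r (lie (vsval H') x) 0 i / v 0 i.
have kE H' : lie (vsval H') x = (k H' : C) *: x.
  have [k' k'E] := ev H'; rewrite k'E; congr (_ *: _).
  by rewrite /k k'E linearZ /= vE mxE mulfK.
have k_lin : linear k.
  by move=> c' H1 H2; rewrite /k linearP lie_linl linearP !mxE mulrDl -mulrA.
pose kL : {linear subvs_of (cartan D) -> C^o} :=
  HB.pack k (GRing.isLinear.Build _ _ _ _ k k_lin).
exists (linfun kL), x; split=> // [H'|]; first by rewrite lfunE /= kE.
rewrite lfunE /=; apply/eqP; rewrite -subr_eq0.
have : ((k H : C) - c) *: x = 0.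
  rewrite scalerBl -kE; apply: (can_inj v2rK).
  by rewrite linearB linearZ /= -v2r_ad_mx vE vH subrr linear0.
by move=> /eqP; rewrite scaler_eq0 (negPf x0) orbF.
Qed.

(** All roots vanish at H, so the diagonalizable map ad H has only the eigenvalue 0 and H is
    central. The line through H is then an ideal: it is zero, or else g would be abelian. *)
Lemma simple_roots_separate H :
  (forall i, simple_root i H = 0 :> C) -> H = 0.
Proof.
move=> alH0; have [_ diag _] := cartanP D.
have comb0 b : nat_comb (@simple_root _ _ D) b -> b H = 0 :> C.
  by case=> c ->; rewrite weight_sumE big1 // => i _; rewrite alH0 mul0rn.
have ev0 (c : C) y : y != 0 -> lie (vsval H) y = c *: y -> c = 0.
  move=> y0 Hy; have [b [x [x0 xR bH]]] := common_root_vector y0 Hy.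
  rewrite -bH; have [->|b0] := eqVneq b 0; first by rewrite zero_lfunE.
  have [_ _ base] := simple_rootP D.
  have [/comb0//|/comb0/eqP] :
      nat_comb (@simple_root _ _ D) b \/ nat_comb (@simple_root _ _ D) (- b).
    by apply: base; split=> //; exists x.
  by rewrite opp_lfunE oppr_eq0 => /eqP.
have H_central y : lie (vsval H) y = 0.
  have [bs [bs_basis bsE]] := diag _ (subvsP H).
  have y_span : y \in <<in_tuple bs>>%VS by rewrite (span_basis bs_basis) memvf.
  rewrite (coord_span y_span) linear_sum big1 //= => i _; rewrite linearZ /=.
  have bi : bs`_i \in bs by apply: mem_nth.
  have [c cE] := bsE _ bi; have c0 : c = 0.
    by apply: ev0 cE; apply: (free_not0 (basis_free bs_basis)).
  by rewrite cE c0 scale0r scaler0.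
apply/eqP; apply: contraT => H0.
have [[x [y xy0]] simple] := g_simple.
have [||fullE] := simple <[vsval H]>%VS.
- by move=> z _ /vlineP[k ->]; rewrite linearZ /= lieC H_central oppr0 scaler0 mem0v.
- move=> /eqP; rewrite -dimv_eq0 dim_vline eqb0 negbK => /eqP vH0.
  by rewrite -(inj_eq subvs_inj) vH0 linear0 eqxx in H0.
have /vlineP[k xE] : x \in <[vsval H]>%VS by rewrite fullE memvf.
by rewrite xE lieZl H_central scaler0 eqxx in xy0.
Qed.

(** Pairing a relation among the coroots with h turns it into a relation among simple roots with
    coefficients scaled by positive numbers, so the coroots are free. They are as many as the rank,
    which bounds dim h because the simple roots embed h into C^rank. *)
Lemma coroot_span H : exists c : 'I_(rank D) -> C, H = \sum_i c i *: coroot_s i.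
Proof.
pose X := [tuple @coroot_s _ _ D i | i < rank D].
have XE (i : 'I_(rank D)) : X`_i = coroot_s i by rewrite -tnth_nth tnth_mktuple.
have X_free : free X.
  apply/freeP => c c0.
  have kc0 i : c i * killing (xplus_s i) (xminus_s i) = 0.
    move: i; apply: simple_roots_free; apply/lfunP => H'.
    rewrite sum_lfunE zero_lfunE.
    transitivity (killing (vsval H') (vsval (\sum_i c i *: X`_i))).
      rewrite linear_sum killing_sumr; apply: eq_bigr => i _.
      rewrite XE linearZ killingZr (killingC (vsval H')) killing_coroot;
        last exact: simple_root_pos.
      by rewrite scale_lfunE [X in _ = _ * X]mulrC mulrA.
    by rewrite c0 linear0 -(scale0r (0 : g)) killingZr mul0r.
  move=> i; have /eqP := kc0 i.
  rewrite mulf_eq0 (gt_eqF (killing_root_vectors_gt0 (simple_root_pos i))) orbF.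
  by move/eqP.
have [ev evE] : exists ev : 'Hom(subvs_of (cartan D), 'rV[C]_(rank D)),
    forall H', ev H' = \row_i (simple_root i H' : C).
  have ev_lin : linear (fun H' => \row_i (simple_root i H' : C)).
    by move=> c H1 H2; apply/rowP => i; rewrite !mxE linearP.
  pose evL : {linear subvs_of (cartan D) -> 'rV[C]_(rank D)} :=
    HB.pack (fun H' => \row_i (simple_root i H' : C))
      (GRing.isLinear.Build _ _ _ _ _ ev_lin).
  by exists (linfun evL) => H'; rewrite lfunE.
have X_span : <<X>>%VS = fullv.
  apply: span_basis; rewrite basisEfree X_free subvf size_tuple /=.
  rewrite -(limg_dim_eq (f := ev)); last first.
    apply/eqP; rewrite capfv; apply/lker0P; apply: raddf_inj => H'.
    move=> evH'; apply: simple_roots_separate => i.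
    by have /rowP/(_ i) := evE H'; rewrite evH' !mxE.
  by apply: leq_trans (dimvS (subvf _)) _; rewrite dimvf /dim /= mul1n.
have H_span : H \in <<X>>%VS by rewrite X_span memvf.
exists (coord X ^~ H); rewrite {1}(coord_span H_span).
by apply: eq_bigr => i _; rewrite XE.
Qed.
End CorootSpan.

End RootData.

(** * Divided powers of a commuting sequence *)

Lemma inv_fact_bin (K : numFieldType) (r i : nat) : (i <= r)%N ->
  (r`!%:R : K)^-1 *+ 'C(r, i) = (i`!%:R)^-1 * ((r - i)`!%:R)^-1.
Proof.
move=> ir; have fact0 n : n`!%:R != 0 :> K by rewrite pnatr_eq0 -lt0n fact_gt0.
apply: (mulfI (fact0 r)); rewrite -(mulr_natr (r`!%:R^-1)) mulrA mulfV // mul1r -invfM.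
by rewrite -(bin_fact ir) !natrM mulfK // mulf_neq0.
Qed.

Lemma scaleXnM (B : nzRingType) (a b : B) m n :
  (a *: 'X^m) * (b *: 'X^n) = (a * b) *: 'X^(m + n) :> {poly B}.
Proof.
rewrite -!mul_polyC polyCM exprD -!mulrA; congr (_ * _).
by rewrite !mulrA (commr_polyXn b%:P).
Qed.

Lemma expr_scaleXn (B : nzRingType) (a : B) m n :
  (a *: 'X^m) ^+ n = a ^+ n *: 'X^(m * n) :> {poly B}.
Proof.
elim: n => [|n IH]; first by rewrite muln0 !expr0 scale1r.
by rewrite !exprS IH scaleXnM mulnS.
Qed.

Lemma coef_expr_low (B : nzRingType) (p q : {poly B}) n s :
  (forall i, (i <= s)%N -> p`_i = q`_i) -> (p ^+ n)`_s = (q ^+ n)`_s.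
Proof.
elim: n s => [|n IH] s pq; first by rewrite !expr0.
rewrite !exprS !coefM; apply: eq_bigr => -[i i_le] _ /=.
rewrite pq // IH // => j j_le; apply: pq; exact: leq_trans j_le (leq_subr _ _).
Qed.

Section DividedPowers.
Context (K : numFieldType) (A : algType K) (x : nat -> A).
Hypothesis x_comm : forall i j, GRing.comm (x i) (x j).

Definition dpow (u : A) (p : nat) : A := (p`!%:R : K)^-1 *: u ^+ p.

(** The element [kx] for an arbitrary commuting sequence, in the same shape so that [kx] is an
    instance by conversion. *)
Definition dpow_sum (k r s : nat) : A :=
  \sum_(b : {ffun 'I_s.+1 -> 'I_r.+1} |
          [&& [forall p : 'I_s.+1, (p < k)%N ==> (b p == 0%N :> nat)],
              (\sum_(p < s.+1) b p)%N == r
            & (\sum_(p < s.+1) p * b p)%N == s])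
    \prod_(p < s.+1 | (k <= p)%N) dpow (x p) (b p).

(** The monomial a u^m z^n: the inner variable u records sum p b_p, the outer variable z records sum
    b_p. *)
Definition bimonom (a : A) (m n : nat) : {poly {poly A}} := (a *: 'X^m) *: 'X^n.

Lemma coef_bimonom a m n i j :
  (bimonom a m n)`_i`_j = if (n == i) && (m == j) then a else 0.
Proof.
rewrite coefZ coefXn eq_sym; case: eqP => _; last by rewrite mulr0 coef0.
by rewrite mulr1 coefZ coefXn eq_sym; case: eqP => _; rewrite ?mulr1 ?mulr0.
Qed.

Lemma bimonomM a m n a' m' n' :
  bimonom a m n * bimonom a' m' n' = bimonom (a * a') (m + m') (n + n').
Proof. by rewrite /bimonom !scaleXnM. Qed.

Lemma prod_bimonom I (r : seq I) (P : pred I) (a : I -> A) (m n : I -> nat) :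
  \prod_(i <- r | P i) bimonom (a i) (m i) (n i) =
  bimonom (\prod_(i <- r | P i) a i) (\sum_(i <- r | P i) m i)
    (\sum_(i <- r | P i) n i).
Proof.
elim: r => [|i r IH]; first by rewrite !big_nil /bimonom !expr0 !alg_polyC.
by rewrite !big_cons; case: (P i) => //; rewrite IH bimonomM.
Qed.

Definition gen_poly (k N : nat) : {poly A} := \poly_(p < N) (x p *+ (k <= p)%N).

Lemma gen_polyE k N : gen_poly k N = \sum_(k <= p < N) x p *: 'X^p.
Proof.
rewrite /gen_poly poly_def big_geq_mkord [RHS]big_mkcond /=.
by apply: eq_bigr => p _; case: ifP; rewrite ?mulr1n // mulr0n scale0r.
Qed.

Lemma comm_gen_poly k N p : GRing.comm (gen_poly k N) (x p *: 'X^p).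
Proof.
rewrite gen_polyE; apply/commr_sym/commr_sum => i _.
by rewrite /GRing.comm !scaleXnM x_comm addnC.
Qed.

Definition dpow_poly (p R : nat) : {poly {poly A}} :=
  \sum_(j < R.+1) bimonom (dpow (x p) j) (p * j) j.

Lemma coef_dpow_poly p R r : (r <= R)%N ->
  (dpow_poly p R)`_r = dpow (x p) r *: 'X^(p * r).
Proof.
move=> rR; rewrite coef_sum (bigD1 (inord r)) //= big1 => [|j j_neq].
  by rewrite addr0 /bimonom inordK // coefZ coefXn eqxx mulr1.
rewrite /bimonom coefZ coefXn; case: eqP => [rj|_]; last by rewrite mulr0.
by case/eqP: j_neq; apply: val_inj; rewrite /= inordK // rj.
Qed.

Lemma polyC_alg_comm (p : {poly A}) (c : K) : p * c%:A%:P = c%:A%:P * p.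
Proof. by apply/polyP => i; rewrite coefMC coefCM mulr_algl mulr_algr. Qed.

(* The exponential [exp (z f)] as the product of the [exp (z x_p u^p)],      *)
(* truncated in degree [> R] in [z].                                         *)
Lemma coef_prod_dpow_poly k N R r : (r <= R)%N ->
  (\prod_(k <= p < N) dpow_poly p R)`_r =
    ((r`!%:R : K)^-1)%:A%:P * gen_poly k N ^+ r.
Proof.
have [n nE] : exists n, n = (N - k)%N by exists (N - k)%N.
elim: n k nE r => [|n IH] k nE r rR.
  have Nk : (N <= k)%N by rewrite -subn_eq0 -nE.
  rewrite gen_polyE !big_geq // coef1.
  by case: r rR => [|r] _; rewrite ?expr0n /= ?invr1 ?scale1r ?mul1r // mulr0.
have k_lt : (k < N)%N by rewrite -subn_gt0 -nE.
rewrite (big_ltn k_lt) coefM gen_polyE (big_ltn k_lt) -gen_polyE addrC.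
rewrite exprDn_comm; last exact: comm_gen_poly.
rewrite mulr_sumr; apply: eq_bigr => -[j j_le] _ /=.
rewrite coef_dpow_poly; last by apply: leq_trans rR.
rewrite IH ?(leq_trans (leq_subr _ _)) //; last by rewrite subnS -nE.
rewrite expr_scaleXn /dpow.
have comm : GRing.comm (gen_poly k.+1 N ^+ (r - j)) (x k ^+ j *: 'X^(k * j)).
  by rewrite -expr_scaleXn; apply/commrX/commr_sym/commrX/commr_sym/comm_gen_poly.
rewrite comm; move: (gen_poly _ _ ^+ _) => q.
set cr := r`!%:R^-1; set c := j`!%:R^-1; set c' := (r - j)`!%:R^-1.
have -> : (c *: x k ^+ j) *: 'X^(k * j) = c%:A%:P * (x k ^+ j *: 'X^(k * j)).
  by rewrite -(mulr_algl c (x k ^+ j)) -!(mul_polyC _ (_ ^+ _)) polyCM mulrA.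
rewrite mulrA -(mulrA c%:A%:P) polyC_alg_comm [RHS]mulrnAr -[RHS]mulrnAl !mulrA.
rewrite -polyCM -polyCMn; congr (_%:P * _ * _).
rewrite mulr_algl scalerA scalerMnl; congr (_ *: _).
by rewrite inv_fact_bin.
Qed.

(** Expanding the product over p chooses one exponent b_p per factor; the exponents of z and u then
    impose the two sum conditions on b. *)
Lemma dpow_sum_coef_prod k r s :
  dpow_sum k r s = ((\prod_(k <= p < s.+1) dpow_poly p r)`_r)`_s.
Proof.
rewrite big_geq_mkord /=.
have -> : \prod_(p < s.+1 | (k <= p)%N) dpow_poly p r =
    \sum_(b in pfamily (ord0 : 'I_r.+1) (fun p : 'I_s.+1 => (k <= p)%N)
                 (fun=> xpredT))
      \prod_(p < s.+1 | (k <= p)%N) bimonom (dpow (x p) (b p)) (p * b p) (b p).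
  exact: big_distr_big_dep.
rewrite !coef_sum.
under [RHS]eq_bigr do rewrite prod_bimonom coef_bimonom.
rewrite -big_mkcondr; apply: eq_bigl => b.
have -> : (b \in pfamily (ord0 : 'I_r.+1) (fun p : 'I_s.+1 => (k <= p)%N)
    (fun=> xpredT)) = [forall p : 'I_s.+1, (p < k)%N ==> (b p == 0%N :> nat)].
  apply/pfamilyP/forallP => [[/subsetP b_supp _] p|b_supp].
    apply/implyP => p_lt; apply: contraTT p_lt; rewrite -leqNgt => bp.
    exact: (b_supp p).
  split=> //; apply/subsetP => p; rewrite inE => bp; rewrite unfold_in leqNgt.
  by apply: contra bp => p_lt; apply/eqP/val_inj/eqP; exact: implyP (b_supp p) p_lt.
case: forallP => //= b_supp.
have low0 (F : nat -> nat -> nat) : (forall p, F p 0%N = 0%N) ->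
    (\sum_(p < s.+1 | (k <= p)%N) F p (b p) = \sum_(p < s.+1) F p (b p))%N.
  move=> F0; rewrite big_mkcond; apply: eq_bigr => p _; case: leqP => // p_lt.
  by have /implyP/(_ p_lt)/eqP -> := b_supp p.
by rewrite (low0 (fun _ m => m)) // (low0 muln) // => p; rewrite muln0.
Qed.

Lemma dpow_sum_coef k r s N : (s < N)%N ->
  dpow_sum k r s = (r`!%:R : K)^-1 *: (gen_poly k N ^+ r)`_s.
Proof.
move=> sN; rewrite dpow_sum_coef_prod coef_prod_dpow_poly // coefCM mulr_algl.
congr (_ *: _); apply: coef_expr_low => i i_le.
by rewrite !coef_poly ltnS i_le (leq_ltn_trans i_le sN).
Qed.

Lemma comm_gen_polys k N k' N' : GRing.comm (gen_poly k N) (gen_poly k' N').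
Proof.
by rewrite (gen_polyE k' N'); apply: commr_sum => i _; apply: comm_gen_poly.
Qed.

(** Binomial theorem for f, split into its terms of degree below k and the rest, with divided powers
    absorbing the binomial coefficients. *)
Lemma dpow_sum_low_part k r s :
  dpow_sum 0 r s = \sum_(i < r.+1) \sum_(j < s.+1)
    (i`!%:R : K)^-1 *: (gen_poly 0 k ^+ i)`_j * dpow_sum k (r - i) (s - j).
Proof.
pose N := (k + s.+1)%N; have sN : (s < N)%N by apply: leq_addl.
rewrite (dpow_sum_coef 0 r sN).
have -> : gen_poly 0 N = gen_poly k N + gen_poly 0 k.
  by rewrite addrC !gen_polyE (big_cat_nat (n := k)) // leq_addr.
rewrite exprDn_comm; last exact: comm_gen_polys.
rewrite coef_sum scaler_sumr; apply: eq_bigr => -[i /= i_le] _.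
have -> : gen_poly k N ^+ (r - i) * gen_poly 0 k ^+ i =
    gen_poly 0 k ^+ i * gen_poly k N ^+ (r - i).
  exact/commrX/commr_sym/commrX/commr_sym/comm_gen_polys.
rewrite coefMn -scalerMnr scalerMnl inv_fact_bin // coefM scaler_sumr.
apply: eq_bigr => -[j /= j_le] _.
rewrite (dpow_sum_coef k _ (leq_ltn_trans (leq_subr j s) sN)).
by rewrite -scalerAl -scalerAr scalerA.
Qed.

Lemma coef_gen_poly_low k n j : (k * n < j + n)%N -> (gen_poly 0 k ^+ n)`_j = 0.
Proof.
elim: n j => [|n IH] j; first by rewrite muln0 addn0 expr0 coef1; case: j.
move=> lt_j; rewrite exprS coefM big1 // => -[i /= i_le] _.
rewrite /gen_poly coef_poly; case: ltnP => [i_lt|_]; last by rewrite mul0r.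
by rewrite IH ?mulr0 //; move: lt_j; rewrite mulnS; lia.
Qed.

(** The degree k r is the lowest in the r-th power of the part of f starting at u^k, so only the
    leading term x_k u^k contributes. *)
Lemma dpow_sum_diag k r : dpow_sum k r (k * r) = dpow (x k) r.
Proof.
pose N := (k + (k * r).+1)%N; have sN : (k * r < N)%N by apply: leq_addl.
rewrite (dpow_sum_coef k r sN); congr (_ *: _).
pose q := \poly_(p < (k * r).+1) x (k + p).
have -> : gen_poly k N = 'X^k * q.
  apply/polyP => p; rewrite coefXnM !coef_poly; case: (leqP k p) => [kp|pk].
    by rewrite mulr1n subnKC // ltn_subLR.
  by rewrite mulr0n if_same.
rewrite exprMn_comm; last by apply/commr_sym/commr_polyXn.
rewrite -exprM coefXnM ltnn subnn.
have q0 : q`_0 = x k by rewrite coef_poly addn0.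
elim: (r) => [|n IH]; first by rewrite !expr0 coef1.
by rewrite !exprS coefM big_ord1 q0 subnn IH.
Qed.

(** * Equivalence of the relations for x(r,s) and _kx(r,s) *)

Section Annihilation.
Context (V : lmodType A) (v : V) (k C : nat).
Hypothesis k_gt0 : (0 < k)%N.

(** The triangular system reaches r = 0, outside the given relations; there the range forces s > 0
    and the element itself is 0. For r > 0 the range forces s > 0 too. *)
Lemma dpow_sum_eq0 l r s :
  ((0 < s)%N -> (0 < r)%N -> (1 + k * r + C <= s + r)%N -> dpow_sum l r s *: v = 0) ->
  (1 + k * r + C <= s + r)%N -> dpow_sum l r s *: v = 0.
Proof.
move=> vanish le_sr; case: r => [|r] in vanish le_sr *; last first.
  by apply: vanish => //; move: le_sr; nia.
have s_neq0 : (s == 0%N) = false by move: le_sr; lia.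
by rewrite (dpow_sum_coef l 0 (ltnSn s)) expr0 coef1 s_neq0 scaler0 scale0r.
Qed.

(** If i + j > k i the low-degree coefficient is zero; otherwise (r - i, s - j) stays in the range,
    since its bound drops by k i, at least i + j. *)
Lemma low_part_term_eq0 r s i j : (i <= r)%N -> (j <= s)%N ->
  (1 + k * r + C <= s + r)%N ->
  ((1 + k * (r - i) + C <= (s - j) + (r - i))%N ->
     dpow_sum k (r - i) (s - j) *: v = 0) ->
  (((i`!%:R : K)^-1 *: (gen_poly 0 k ^+ i)`_j) * dpow_sum k (r - i) (s - j)) *: v = 0.
Proof.
move=> i_le j_le le_sr vanish; have [lt_ij|le_ij] := ltnP (k * i) (j + i).
  by rewrite coef_gen_poly_low // scaler0 mul0r scale0r.
rewrite -scalerA vanish ?scaler0 // mulnBr.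
have : (k * i <= k * r)%N by rewrite leq_mul2l i_le orbT.
by move: le_sr; lia.
Qed.

Lemma dpow_sum_annihilated :
  (forall r s, (0 < s)%N -> (0 < r)%N -> (1 + k * r + C <= s + r)%N ->
     dpow_sum 0 r s *: v = 0) <->
  (forall r s, (0 < s)%N -> (0 < r)%N -> (1 + k * r + C <= s + r)%N ->
     dpow_sum k r s *: v = 0).
Proof.
split=> vanish r s _ _.
  (* Solving the system by induction on r: the terms with i = 0 reduce to _kx(r,s) itself, and all
     others involve a smaller r. *)
  have [m] := ubnP r; elim: m => // m IH in r s * => r_le le_sr.
  have := dpow_sum_eq0 (vanish r s) le_sr.
  rewrite (dpow_sum_low_part k) big_ord_recl scalerDl.
  rewrite [X in X *: v + _](_ : _ = dpow_sum k r s); last first.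
    rewrite big_ord_recl /= fact0 invr1 scale1r expr0 coef1 mul1r !subn0.
    by rewrite [X in _ + X]big1 ?addr0 // => j _; rewrite coef1 scaler0 mul0r.
  rewrite [X in _ + X](_ : _ = 0) ?addr0 // scaler_suml big1 // => -[i /= i_lt] _.
  rewrite scaler_suml big1 // => -[j /= j_le] _.
  apply: low_part_term_eq0 => // le_sr'; apply: IH le_sr'.
  by rewrite /bump /=; lia.
move=> le_sr; rewrite (dpow_sum_low_part k) scaler_suml big1 // => -[i /= i_lt] _.
rewrite scaler_suml big1 // => -[j /= j_le] _.
by apply: low_part_term_eq0 => // le_sr'; apply: dpow_sum_eq0 le_sr'; apply: vanish.
Qed.

End Annihilation.

(** * Garland's identity *)

Section Garland.
(** The model is E = x^+ t, x i = x^- t^i and h i = (coroot) t^(i+1). *)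
Context (h : nat -> A) (E : A).
Hypotheses (Ex : forall i, E * x i = x i * E + h i)
  (hx : forall i j, h i * x j = x j * h i - 2 *: x (i + j).+1).

Section Truncated.
Variable N : nat.
Let f := gen_poly 0 N.
Let H : {poly A} := \poly_(i < N) h i.
(* [H f - f H = - 2 Q], and [Q] agrees with [f'] in degrees [< N - 1].      *)
Let mult (n : nat) : nat := \sum_(i < n.+1) ((i < N) && (n - i < N))%N.
Let Q : {poly A} := \poly_(n < N + N) (x n.+1 *+ mult n).

Lemma coef_commutator_poly n : Q`_n = x n.+1 *+ mult n.
Proof.
rewrite coef_poly; case: ltnP => // n_ge; rewrite /mult big1 ?mulr0n // => i _.
by case: ltnP => //= i_lt; apply/eqP; rewrite eqb0 -leqNgt; lia.
Qed.

Lemma coef_commutator_poly_low n : (n.+1 < N)%N -> Q`_n = f^`()`_n.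
Proof.
move=> n_lt; rewrite coef_commutator_poly coef_deriv coef_poly n_lt mulr1n.
congr (_ *+ _); rewrite /mult (eq_bigr (fun=> 1%N)) ?sum1_card ?card_ord //.
by move=> [i /= i_le] _; rewrite !(leq_ltn_trans _ (ltnW n_lt)) // leq_subr.
Qed.

Lemma comm_poly_gen_poly (p : {poly A}) :
  (forall i j, GRing.comm p`_i (x j)) -> GRing.comm f p.
Proof.
move=> p_comm; apply/polyP => n; rewrite coefM coefMr; apply: eq_bigr => i _.
by rewrite coef_poly; case: ifP; rewrite ?mulr1n ?mul0r ?mulr0 // p_comm.
Qed.

Lemma comm_commutator_poly : GRing.comm f Q.
Proof.
apply: comm_poly_gen_poly => i j; rewrite coef_commutator_poly.
exact/commr_sym/commrMn.
Qed.

Lemma cartan_gen_poly : H * f = f * H - Q *+ 2.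
Proof.
apply/polyP => n; rewrite coefM coefB coefMr coefMn coef_commutator_poly /mult.
rewrite -sumrMnr -sumrMnl -sumrB; apply: eq_bigr => -[i /= i_le] _.
rewrite !coef_poly; case: (i < N)%N; last by rewrite mul0r mulr0 mulr0n mul0rn subr0.
case: (n - i < N)%N; last by rewrite mul0r mulr0 mulr0n mul0rn subr0.
by rewrite !mulr1n hx subnKC // scaler_nat.
Qed.

Lemma raising_gen_poly : E%:P * f = f * E%:P + H.
Proof.
apply/polyP => i; rewrite coefD coefCM coefMC !coef_poly.
by case: ltnP; rewrite ?mulr1n ?Ex // mulr0 mul0r addr0.
Qed.

(** Moving E through f leaves H, and moving H to the right past a factor f costs 2Q; these costs add
    up to r(r+1). For r = 0 the truncated exponent [r.-1] is harmless because its coefficient is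
    0. *)
Lemma raising_gen_polyX r :
  E%:P * f ^+ r.+1 = f ^+ r.+1 * E%:P + (f ^+ r * H) *+ r.+1
    - (Q * f ^+ r.-1) *+ (r.+1 * r).
Proof.
elim: r => [|r IH].
  by rewrite !expr1 expr0 mul1r muln0 mulr0n subr0 mulr1n raising_gen_poly.
rewrite exprSr mulrA IH mulrBl mulrDl -(mulrA _ E%:P) raising_gen_poly.
rewrite mulrnAl -(mulrA _ H) cartan_gen_poly.
have -> : Q * f ^+ r.-1 *+ (r.+1 * r) * f = Q * f ^+ r *+ (r.+1 * r).
  by case: r {IH} => [|r]; rewrite ?muln0 ?mulr0n ?mul0r // mulrnAl -mulrA -exprSr.
rewrite mulrDr mulrBr !mulrA -!exprSr mulrnBl addrA.
rewrite -(addrA _ (f ^+ r.+1 * H)) -mulrS -[LHS]addrA; congr (_ + _).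
have -> : f ^+ r * (Q *+ 2) = (Q * f ^+ r) *+ 2.
  rewrite mulrnAr; congr (_ *+ _).
  exact/commr_sym/commrX/commr_sym/comm_commutator_poly.
rewrite -mulrnA -opprD -mulrnDr; congr (- (_ *+ _)); lia.
Qed.

Lemma deriv_gen_polyX r : (f ^+ r.+1)^`() = (f^`() * f ^+ r) *+ r.+1.
Proof.
elim: r => [|r IH]; first by rewrite expr0 mulr1.
have comm : GRing.comm f f^`().
  apply: comm_poly_gen_poly => i j; rewrite coef_deriv coef_poly.
  by apply/commr_sym/commrMn; case: ifP => _; [apply: commrMn | apply: commr0].
rewrite exprS derivM IH mulrnAr mulrA comm -mulrA -exprS -mulrS.
by [].
Qed.

End Truncated.

Context (V : lmodType A) (v : V).
Hypotheses (Ev : E *: v = 0) (hv : forall i, h i *: v = 0).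

(** On v the terms ending in E or H die and Q acts as f', leaving -(r+1) times the derivative of
    f^r. The bound on s keeps to degrees where truncation has no effect. *)
Lemma raising_coef_gen_polyX N r s : (s.+1 < N)%N ->
  (E * (gen_poly 0 N ^+ r.+1)`_s) *: v =
    - ((gen_poly 0 N ^+ r)`_s.+1 *+ (s.+1 * r.+1)) *: v.
Proof.
move=> s_lt; rewrite -coefCM raising_gen_polyX coefB coefD coefMC coefMn.
rewrite !coefMn scalerBl scalerDl -scalerA Ev scaler0 add0r.
rewrite coefM -mulr_natl -scalerA scaler_suml big1 ?scaler0 ?sub0r => [|i _]; last first.
  rewrite -scalerA coef_poly; case: ifP => _; rewrite ?hv ?scale0r ?scaler0 //.
rewrite -scaleNr; congr (- _ *: _); rewrite mulnC mulrnA mulrnA; congr (_ *+ _).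
case: r => [|r]; first by rewrite mulr0n expr0 coef1 mul0rn.
rewrite -coef_deriv deriv_gen_polyX coefMn; congr (_ *+ _).
rewrite !coefM; apply: eq_bigr => -[i /= i_le] _; congr (_ * _).
by rewrite coef_commutator_poly_low //; apply: leq_ltn_trans s_lt.
Qed.

(** Each application of E lowers the power of f by one and raises the degree of the coefficient by
    one, up to a nonzero scalar; the start is the constant coefficient of f^(s+r). *)
Lemma garland r s : (E ^+ s * x 0 ^+ (s + r)) *: v = 0 <-> dpow_sum 0 r s *: v = 0.
Proof.
pose N := s.+1; pose f := gen_poly 0 N.
have raise n : (n <= s)%N -> forall r, exists2 c : K, c != 0 &
    (E ^+ n * (f ^+ (n + r))`_0) *: v = (c *: (f ^+ r)`_n) *: v.
  elim: n => [_|n IH n_lt] r'.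
    by exists 1; rewrite ?oner_eq0 // expr0 mul1r scale1r.
  have [c c_neq0 cE] := IH (ltnW n_lt) r'.+1.
  exists (- c * (n.+1 * r'.+1)%:R); first by rewrite mulf_neq0 ?oppr_eq0 ?pnatr_eq0.
  rewrite exprS -mulrA -scalerA addSnnS cE scalerA -scalerAr.
  rewrite -mulr_algl -scalerA raising_coef_gen_polyX ?ltnS // scalerA mulr_algl.
  by rewrite scalerN -scaleNr -scalerA scaler_nat.
have f0 n : (f ^+ n)`_0 = x 0 ^+ n.
  elim: n => [|n IH]; first by rewrite !expr0 coef1.
  by rewrite !exprS coefM big_ord1 IH coef_poly mulr1n.
have [c c_neq0] := raise s (leqnn s) r; rewrite f0 => ->.
rewrite (dpow_sum_coef 0 r (ltnSn s)) -/f.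
have scale_eq0 (c1 : K) (a : A) : c1 != 0 -> (c1 *: a) *: v = 0 <-> a *: v = 0.
  move=> c1_neq0; split=> [av0|av0]; last by rewrite -mulr_algl -scalerA av0 scaler0.
  by rewrite -[a]scale1r -(mulVf c1_neq0) -scalerA -mulr_algl -scalerA av0 scaler0.
rewrite !scale_eq0 // invr_eq0 pnatr_eq0 -lt0n fact_gt0 //.
Qed.

End Garland.
End DividedPowers.

(** * The modules *)

Section QuotientModuleTheory.
Context (A : pzRingType) (M : lmodType A) (S : M -> Prop).

Lemma quot_piZ a x : quot_module_pi S (a *: x) = a *: quot_module_pi S x.
Proof. exact: quot_module_piZ. Qed.

Lemma quot_pi_eq0 x : quot_module_pi S x = 0 <-> submod_gen S x.
Proof.
have -> : 0 = quot_module_pi S 0 by rewrite -[in RHS](scale0r (0 : M)) quot_piZ scale0r.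
by rewrite quot_module_piP subr0.
Qed.

Lemma quot_pi_rel x : S x -> quot_module_pi S x = 0.
Proof.
move=> Sx; apply/quot_pi_eq0; rewrite -[x]addr0 -[X in X + 0]scale1r.
by apply: submod_genD => //; apply: submod_gen0.
Qed.

End QuotientModuleTheory.

Lemma quot_pi1 (A : pzRingType) (S : A^o -> Prop) (a : A) :
  a *: quot_module_pi S 1 = quot_module_pi S (a : A^o).
Proof. by rewrite -quot_piZ /GRing.scale /= mulr1. Qed.

Section CurrentAction.
Context (C : numClosedFieldType) (g : finLieAlgType C) (D : root_data g).
Local Notation U := (envel (current g)).

Lemma ut_lin (c : C) (x y : g) s : ut (c *: x + y) s = c *: ut x s + ut y s.
Proof. by rewrite /ut tensor_pow_lin envel_in_lin. Qed.

Lemma ut0 s : ut (0 : g) s = 0.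
Proof. by rewrite -(addNr (0 : g)) -scaleN1r ut_lin scaleN1r addNr. Qed.

Lemma utZ (c : C) (x : g) s : ut (c *: x) s = c *: ut x s.
Proof. by rewrite -[c *: x]addr0 ut_lin ut0 addr0. Qed.

Lemma ut_lie (x y : g) i j :
  ut (lie x y) (i + j) = ut x i * ut y j - ut y j * ut x i.
Proof. by rewrite /ut -current_lie_tensor -envel_in_lie. Qed.

Lemma ut_comm (x : g) i j : GRing.comm (ut x i) (ut x j).
Proof. by apply/eqP; rewrite -subr_eq0 -ut_lie liexx ut0. Qed.

Context (V : lmodType U) (v : V).

Lemma scale_alg (c : C) (u : U) : (c *: u) *: v = c%:A *: (u *: v).
Proof. by rewrite scalerA mulr_algl. Qed.

Lemma envel_in_annihilates (p : current g) :
  (forall s, ut (current_coef p s) s *: v = 0) -> envel_in p *: v = 0.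
Proof.
move=> pv; rewrite -[p]current_scale1 /current_scale.
apply: (big_ind (fun q : current g => envel_in q *: v = 0)) => [|q q' qv q'v|s _].
- by rewrite -(tensor_pow0 g 0) -[envel_in _]/(ut 0 0) ut0 scale0r.
- by rewrite -[q]scale1r envel_in_lin scale1r scalerDl qv q'v addr0.
by rewrite scale1r -[envel_in _]/(ut _ s) pv.
Qed.

Lemma kx_annihilated (a : weight (cartan D)) (k c : nat) : pos_root a -> (0 < k)%N ->
  (forall s, ut (xplus a) s *: v = 0) ->
  (forall s, ut (vsval (coroot a)) s.+1 *: v = 0) ->
  (forall r s, (0 < s)%N -> (0 < r)%N -> (1 + k * r + c <= s + r)%N ->
    (ut (xplus a) 1 ^+ s * ut (xminus a) 0 ^+ (s + r)) *: v = 0) <->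
  (forall r s, (0 < s)%N -> (0 < r)%N -> (1 + k * r + c <= s + r)%N ->
    kx (xminus a) k r s *: v = 0).
Proof.
move=> a_pos k_gt0 ev hv; have [_ _ he hf ef] := root_tripleP a_pos.
pose h i := ut (vsval (coroot a)) i.+1.
have Ex i : ut (xplus a) 1 * ut (xminus a) i = ut (xminus a) i * ut (xplus a) 1 + h i.
  by rewrite /h -ef -(add1n i) ut_lie addrC subrK.
have hx i j : h i * ut (xminus a) j =
    ut (xminus a) j * h i - 2 *: ut (xminus a) (i + j).+1.
  apply/eqP; rewrite addrC -subr_eq -ut_lie hf -scaleNr utZ addSn scaleNr.
  by [].
have G r s := garland (ut_comm (xminus a)) Ex hx (ev 1%N) hv r s.
have [to_k from_k] := dpow_sum_annihilated (ut_comm (xminus a)) v c k_gt0.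
split=> vanish r s s_gt0 r_gt0 le_sr.
  by apply: to_k le_sr => // r' s' s'_gt0 r'_gt0 le_sr'; apply/G/vanish.
by apply/G; apply: from_k le_sr => // r' s'; apply: vanish.
Qed.

Lemma kx_diag (x : g) k r : kx x k r (k * r) = (r`!%:R : C)^-1 *: ut x k ^+ r.
Proof. exact: (dpow_sum_diag (ut_comm x) k r). Qed.

Hypothesis plus_v : forall i s, ut (xplus_s (D := D) i) s *: v = 0.

(** The z in g with z t^s v = 0 for all s form a Lie subalgebra, because [z, z'] t^s =
    [z t^0, z' t^s]; it contains the simple root vectors. *)
Lemma positive_root_annihilates a y s :
  pos_root (D := D) a -> root_space a y -> ut y s *: v = 0.
Proof.
move=> a_pos yR.
pose S (z : g) := forall s, ut z s *: v = 0.
suff : S y by apply.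
apply: simple_roots_generate a_pos yR => [c z z' Sz Sz' t|t|z z' Sz Sz' t|i t].
- by rewrite ut_lin scalerDl scale_alg Sz Sz' scaler0 addr0.
- by rewrite ut0 scale0r.
- by rewrite -[t]add0n ut_lie scalerBl -!scalerA Sz Sz' !scaler0 subrr.
exact: plus_v.
Qed.

Lemma nplus_annihilates (p : current g) :
  sub_current (nplus D) p -> envel_in p *: v = 0.
Proof.
move=> p_plus; apply: envel_in_annihilates => s.
elim: (p_plus s) => [|c y z [a [a_pos yR]] _ IH]; first by rewrite ut0 scale0r.
rewrite ut_lin scalerDl IH addr0 scale_alg.
by rewrite (positive_root_annihilates s a_pos yR) scaler0.
Qed.

Lemma cartan_weight (lam : weight (cartan D)) (H : subvs_of (cartan D)) s :
  simple_lie g ->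
  (forall i, (ut (vsval (coroot_s (D := D) i)) s
     - ((lam (coroot_s i) : C) * (s == 0%N)%:R)%:A) *: v = 0) ->
  (ut (vsval H) s - ((s == 0%N)%:R * (lam H : C))%:A) *: v = 0.
Proof.
move=> g_simple wt; have [c HE] := coroot_span g_simple H.
pose P (H : subvs_of (cartan D)) :=
  (ut (vsval H) s - ((s == 0%N)%:R * (lam H : C))%:A) *: v = 0.
rewrite -[_ = 0]/(P H) HE; apply: (big_ind P) => [|H1 H2 P1 P2|i _]; rewrite /P.
- by rewrite !linear0 ut0 mulr0 scale0r subr0 scale0r.
- rewrite !linearD /= -[vsval H1]scale1r ut_lin !scale1r mulrDr (scalerDl 1) opprD.
  by rewrite addrACA scalerDl P1 P2 addr0.
rewrite !linearZ utZ /=.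
have -> : ((s == 0%N)%:R * (c i *: lam (coroot_s i) : C)) =
    c i * (lam (coroot_s i) * (s == 0%N)%:R) by rewrite mulrC -mulrA.
by rewrite -scalerA -scalerDr scalerN scale_alg wt scaler0.
Qed.

End CurrentAction.

(** * Comparison of the two annihilators *)

Section Presentation.
Context (C : numClosedFieldType) (g : finLieAlgType C) (D : root_data g).
Local Notation U := (envel (current g)).
Hypothesis g_simple : simple_lie g.
Context (lam : weight (cartan D)) (xi : weight (cartan D) -> seq nat).

Lemma coroot_current_annihilates (V : lmodType U) (v : V) :
  (forall (H : subvs_of (cartan D)) s,
     (ut (vsval H) s - ((s == 0%N)%:R * (lam H : C))%:A) *: v = 0) ->
  forall (H : subvs_of (cartan D)) s, ut (vsval H) s.+1 *: v = 0.
Proof. by move=> wt H s; have := wt H s.+1; rewrite mul0r scale0r subr0. Qed.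

Lemma scale_v_gen (a : U) :
  a *: w_gen lam = 0 -> a *: v_gen lam xi = 0.
Proof.
move=> aw; rewrite /v_gen -quot_piZ aw -(scale0r 0) quot_piZ scale0r.
by [].
Qed.

Lemma v_gen_local_weyl_rel (a : U) : local_weyl_rel lam a -> a *: v_gen lam xi = 0.
Proof. by move=> rel; apply: scale_v_gen; rewrite quot_pi1; apply: quot_pi_rel. Qed.

Lemma v_gen_xplus i s : ut (xplus_s (D := D) i) s *: v_gen lam xi = 0.
Proof.
apply/v_gen_local_weyl_rel/(@local_weyl_plus _ _ _ _ i) => t.
by rewrite current_coef_tensor; case: eqP; rewrite ?mem0v // => _; apply: memv_line.
Qed.

Lemma v_gen_cartan (H : subvs_of (cartan D)) s :
  (ut (vsval H) s - ((s == 0%N)%:R * (lam H : C))%:A) *: v_gen lam xi = 0.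
Proof.
apply: cartan_weight => // i; apply/v_gen_local_weyl_rel/local_weyl_cartan.
Qed.

Lemma v_gen_raising a k s r :
  pos_root (D := D) a -> (0 < k)%N -> (0 < s)%N -> (0 < r)%N ->
  (1 + k * r + sumn (drop k (xi a)) <= s + r)%N ->
  (ut (xplus a) 1 ^+ s * ut (xminus a) 0 ^+ (s + r)) *: v_gen lam xi = 0.
Proof.
move=> a_pos k_gt0 s_gt0 r_gt0 le_sr; rewrite /v_gen -quot_piZ.
apply: quot_pi_rel; apply: (@V_xi_relI _ _ _ _ _ a s r k) => //.
by rewrite mulnC in le_sr *.
Qed.

Lemma v_gen_kx a s r k : pos_root (D := D) a -> (0 < s)%N -> (0 < r)%N -> (0 < k)%N ->
  (1 + k * r + sumn (drop k (xi a)) <= s + r)%N ->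
  kx (xminus a) k r s *: v_gen lam xi = 0.
Proof.
move=> a_pos s_gt0 r_gt0 k_gt0; move: r s r_gt0 s_gt0.
have [||+ _] := @kx_annihilated _ _ D _ (v_gen lam xi) a k (sumn (drop k (xi a)))
  a_pos k_gt0.
- move=> s; apply: (positive_root_annihilates v_gen_xplus s a_pos).
  by have [[]] := root_tripleP a_pos.
- exact: coroot_current_annihilates v_gen_cartan _.
move=> to_kx r s r_gt0 s_gt0; apply: to_kx => // r' s' s'_gt0 r'_gt0.
exact: v_gen_raising.
Qed.

Lemma v_gen_defining_rel (a : U) : V_xi_defining_rel lam xi a -> a *: v_gen lam xi = 0.
Proof.
case=> [p p_plus|H s|i m lam_i|b s r k b_pos s_gt0 r_gt0 k_gt0 le_sr].
- exact: nplus_annihilates v_gen_xplus p p_plus.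
- exact: v_gen_cartan.
- exact/v_gen_local_weyl_rel/local_weyl_minus.
exact: v_gen_kx.
Qed.

(** The universal vector satisfying the new relations: its annihilator is exactly the left ideal
    they generate. *)
Let q := quot_module_pi (V_xi_defining_rel lam xi) 1.

Lemma q_defining_rel (a : U) : V_xi_defining_rel lam xi a -> a *: q = 0.
Proof. by move=> rel; rewrite quot_pi1; apply: quot_pi_rel. Qed.

Lemma q_cartan (H : subvs_of (cartan D)) s :
  (ut (vsval H) s - ((s == 0%N)%:R * (lam H : C))%:A) *: q = 0.
Proof. exact/q_defining_rel/V_xi_cartan. Qed.

Lemma q_root_space a y s : pos_root (D := D) a -> root_space a y -> ut y s *: q = 0.
Proof.
move=> a_pos yR; apply/q_defining_rel/V_xi_plus => t; rewrite current_coef_tensor.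
case: eqP => _; last exact: submod_gen0.
rewrite -[y]addr0 -[y in y + 0]scale1r.
by apply: submod_genD; [exists a | apply: submod_gen0].
Qed.

Lemma q_local_weyl_rel (a : U) : local_weyl_rel lam a -> a *: q = 0.
Proof.
case=> [i p p_plus|i s|i m lam_i].
- apply: envel_in_annihilates => s; have /vlineP[c ->] := p_plus s.
  rewrite utZ scale_alg (@q_root_space (simple_root i)) ?scaler0 //.
    exact: simple_root_pos.
  by have [[]] := root_tripleP (simple_root_pos i).
- by rewrite mulrC; apply: q_cartan.
exact/q_defining_rel/V_xi_minus.
Qed.

Lemma q_raising a s r k : pos_root (D := D) a -> (0 < s)%N -> (0 < r)%N -> (0 < k)%N ->
  (1 + r * k + sumn (drop k (xi a)) <= s + r)%N ->
  (ut (xplus a) 1 ^+ s * ut (xminus a) 0 ^+ (s + r)) *: q = 0.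
Proof.
rewrite mulnC => a_pos s_gt0 r_gt0 k_gt0; move: r s r_gt0 s_gt0.
have [||_ +] := @kx_annihilated _ _ D _ q a k (sumn (drop k (xi a))) a_pos k_gt0.
- by move=> s; apply: (q_root_space _ a_pos); have [[]] := root_tripleP a_pos.
- exact: coroot_current_annihilates q_cartan _.
move=> from_kx r s r_gt0 s_gt0; apply: from_kx => // r' s' s'_gt0 r'_gt0 le_sr.
exact/q_defining_rel/V_xi_kx.
Qed.

Lemma w_gen_annihilator (a : U) : a *: w_gen lam = 0 -> a *: q = 0.
Proof.
rewrite quot_pi1 => /quot_pi_eq0; elim=> [|b s x rel _ IH]; first by rewrite scale0r.
by rewrite scalerDl IH addr0 -[b *: s]/(b * s) -scalerA q_local_weyl_rel ?scaler0.
Qed.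

Lemma v_gen_annihilator (a : U) : a *: v_gen lam xi = 0 -> a *: q = 0.
Proof.
rewrite -quot_piZ => /quot_pi_eq0 aw_rel.
(* The induction runs over the submodule of the local Weyl module, so the claim is made for every
   lift b of y to U; subtracting from the lift a multiple of the generating relation, which kills q,
   passes to the smaller element. *)
suff ind y : submod_gen (V_xi_rel lam xi) y ->
    forall b : U, b *: w_gen lam = y -> b *: q = 0 by exact: ind aw_rel a erefl.
clear a aw_rel; elim=> [|b _ x [c s r k c_pos s_gt0 r_gt0 k_gt0 le_sr] _ IH] a aw.
  exact: w_gen_annihilator.
set u := ut _ 1 ^+ s * _ in aw.
have uq : u *: q = 0 by apply: q_raising le_sr.
have := IH (a - b * u); rewrite !scalerBl -!(scalerA b u) uq scaler0 subr0; apply.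
by rewrite aw addrC addKr.
Qed.

Lemma v_gen_presented : presented_by (v_gen lam xi) (V_xi_defining_rel lam xi).
Proof.
split=> [x|a].
  (* Two representatives, since the module is a quotient of a quotient of U. *)
  exists (repr (repr x)); rewrite /v_gen -quot_piZ quot_pi1.
  by rewrite /quot_module_pi !reprK.
split=> [/v_gen_annihilator|]; first by rewrite quot_pi1 => /quot_pi_eq0.
elim=> [|b s x rel _ IH]; first by rewrite scale0r.
by rewrite scalerDl IH addr0 -[b *: s]/(b * s) -scalerA v_gen_defining_rel ?scaler0.
Qed.

(** Take s = k r: the bound on s + r becomes the bound on r, and [kx] reduces to the r-th divided
    power of x^- t^k. *)
Lemma v_gen_xminus_power a r k : pos_root (D := D) a -> (0 < r)%N -> (0 < k)%N ->
  (1 + sumn (drop k (xi a)) <= r)%N -> ut (xminus a) k ^+ r *: v_gen lam xi = 0.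
Proof.
move=> a_pos r_gt0 k_gt0 le_r.
have := @v_gen_kx a (k * r) r k a_pos _ r_gt0 k_gt0.
rewrite muln_gt0 k_gt0 r_gt0 => /(_ isT); rewrite kx_diag scale_alg.
rewrite addnAC (addnC (k * r)) leq_add2r.
move=> /(_ le_r) /(congr1 (fun w => ((r`!%:R : C)%:A : U) *: w)).
rewrite scaler0 -scale_alg -scale_alg scalerA mulfV ?scale1r //.
by rewrite pnatr_eq0 -lt0n fact_gt0.
Qed.

End Presentation.

Unset Implicit Arguments.

Theorem proposition2p7 (R : realType) (g : finLieAlgType R[i])
    (g_simple : simple_lie g) (D : root_data g)
    (lam : weight (cartan D)) (lam_dominant : dominant lam) (lam_neq0 : lam != 0)
    (xi : weight (cartan D) -> seq nat) (xi_compatible : compatible lam xi) :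
  presented_by (v_gen lam xi) (V_xi_defining_rel lam xi) /\
  (forall (a : weight (cartan D)) (r k : nat),
      pos_root a -> (0 < r)%N -> (0 < k)%N ->
      (1 + sumn (drop k (xi a)) <= r)%N ->
      ut (xminus a) k ^+ r *: v_gen lam xi = 0).
Proof.
split; first exact: v_gen_presented.
by move=> a r k; apply: v_gen_xminus_power.
Qed.
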